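(* Let $Q\in\mathbb{R}^{m\times m}$ be symmetric positive semidefinite, $c\in\mathbb{R}^m$, $d\in\mathbb{R}$, and consider the problem $\min\{q(x)=x^\top Qx+c^\top x+d : x\in\mathbb{R}^m,\ x\ge 0\}$. Assume that there exists an accumulation point $x^\star$ of the sequence $\{x^k\}$ generated by the algorithm FAST-QPA such that the submatrix $Q_{\hat{\mathcal{N}}\hat{\mathcal{N}}}$ is positive definite, where $\hat{\mathcal{N}}=\{i\in\{1,\dots,m\}: x^\star_i>0\}\cup\{i\in\{1,\dots,m\}: x^\star_i=0,\ g_i(x^\star)=0\}$ and $g(x)=2Qx+c$. Then FAST-QPA produces a minimizer of the problem in a finite number of steps.
   Context: Problem (QP): $\min\{q(x)=x^\top Qx+c^\top x+d : x\in\mathbb{R}^m,\ x\ge 0\}$. Let $g(x)=2Qx+c$ be the gradient of $q$. $\lambda_{\max}(Q)$ is the largest eigenvalue of $Q$. For an index set $I\subseteq\{1,\dots,m\}$, $v_I$ is the subvector of $v$ indexed by $I$ and $M_{II}$ the corresponding principal submatrix of $M$. $[z]^\sharp=\max\{0,z\}$ componentwise. Active set estimate: for $x\in\mathbb{R}^m$ and a fixed scalar $\varepsilon>0$, $\mathcal{N}(x)=\{i\in\{1,\dots,m\}: x_i>\varepsilon g_i(x)\}$ and $\mathcal{A}(x)=\{1,\dots,m\}\setminus\mathcal{N}(x)$. Algorithm FAST-QPA. Fix $\delta\in(0,1)$, $\gamma\in(0,\frac12)$ and $\varepsilon$ with $0<\varepsilon<\frac{1}{2\lambda_{\max}(Q)}$.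 Choose $x^0\in\mathbb{R}^m_+$. For $k=0,1,2,\dots$: (1) If $x^k$ is optimal, stop. (2) Compute $\mathcal{A}^k=\mathcal{A}(x^k)$ and $\mathcal{N}^k=\mathcal{N}(x^k)$. (3) Set $\tilde x^k_{\mathcal{A}^k}=0$ and $\tilde x^k_{\mathcal{N}^k}=x^k_{\mathcal{N}^k}$. (4) Set $d^k_{\mathcal{A}^k}=0$. (5) Compute a gradient related direction $d^k_{\mathcal{N}^k}$ in $\tilde x^k$ and the point $\bar x^k$, by means of the direction routine below. Here $d_{\mathcal{N}^k}$ is called gradient related at $\tilde x^k$ if there exist $\sigma_1,\sigma_2>0$ such that $d_{\mathcal{N}^k}^\top g(\tilde x^k)_{\mathcal{N}^k}\le-\sigma_1\|g(\tilde x^k)_{\mathcal{N}^k}\|^2$ and $\|d_{\mathcal{N}^k}\|\le\sigma_2\|g(\tilde x^k)_{\mathcal{N}^k}\|$. (6) If $\bar x^k$ is optimal, stop. (7) Set $\alpha^k=\delta^j$, where $j$ is the first non-negative integer for which $q([\tilde x^k+\delta^jd^k]^\sharp)\le q(\tilde x^k)+\gamma\delta^j g(\tilde x^k)^\top d^k$. (8) Set $x^{k+1}=[\tilde x^k+\alpha^kd^k]^\sharp$. Direction routine (a conjugate gradient type method for the unconstrained problem $\min_{y\in\mathbb{R}^{|\mathcal{N}^k|}} y^\top\widetilde Qy+\tilde c^\top y$ with $\widetilde Q=Q_{\mathcal{N}^k\mathcal{N}^k}$, $\tilde c=g(\tilde x^k)_{\mathcal{N}^k}$). Set $y^0=0$,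 $\tilde g^0=\widetilde Q\,\tilde x^k_{\mathcal{N}^k}+\tilde c$, $p^0=-\tilde g^0$, $\eta>0$, $l=0$, check = true. While $(p^l)^\top\widetilde Qp^l>0$: if $(p^l)^\top\widetilde Qp^l\le\eta\|p^l\|^2$ and check = true, set $\hat y=-\tilde g^0$ if $l=0$, $\hat y=y^l$ if $l>0$, and check = false; then compute $\alpha^l=\|\tilde g^l\|^2/((p^l)^\top\widetilde Qp^l)$, $y^{l+1}=y^l+\alpha^lp^l$, $\tilde g^{l+1}=\tilde g^l+\alpha^l\widetilde Qp^l$, $\beta^{l+1}=\|\tilde g^{l+1}\|^2/\|\tilde g^l\|^2$, $p^{l+1}=-\tilde g^{l+1}+\beta^{l+1}p^l$, and set $l=l+1$. After the loop, if check = true, set $\hat y=-\tilde g^0$ if $l=0$ and $\hat y=y^l$ if $l>0$. Return $d^k_{\mathcal{N}^k}=\hat y$ and the point $\bar x^k$ with $\bar x^k_{\mathcal{A}^k}=0$ and $\bar x^k_{\mathcal{N}^k}=-\tilde g^0$ if $l=0$, $\bar x^k_{\mathcal{N}^k}=y^l$ if $l>0$.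
   Formalization: The direction routine is corrected, since the claim fails as printed (m=1, q=x²): g̃⁰ is taken as g(x̃^k)_N/2 (i.e. Q̃x̃_N + c_N/2) instead of Q̃x̃_N + g(x̃^k)_N, and x̄_N is x̃_N + y^l (or x̃_N − g̃⁰ if l=0) instead of y^l (or −g̃⁰). *)

(* Defs.v *)
From HB Require Import structures.
From mathcomp Require Import all_boot all_order all_algebra.
From mathcomp Require Import all_classical all_reals all_analysis.

Set Implicit Arguments.
Unset Strict Implicit.
Unset Printing Implicit Defensive.

Import Order.TTheory GRing.Theory Num.Theory.
Import numFieldNormedType.Exports.

Local Open Scope classical_set_scope.
Local Open Scope ring_scope.

Definition dot (R : realType) (n : nat) (u v : 'cV[R]_n) : R :=
  (u^T *m v) ord0 ord0.

Definition quad (R : realType) (n : nat) (M : 'M[R]_n) (v : 'cV[R]_n) : R :=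
  (v^T *m M *m v) ord0 ord0.

Definition psd (R : realType) (n : nat) (M : 'M[R]_n) : Prop :=
  M^T = M /\ forall v : 'cV[R]_n, 0 <= quad M v.

Definition posdef (R : realType) (n : nat) (M : 'M[R]_n) : Prop :=
  M^T = M /\ forall v : 'cV[R]_n, v != 0 -> 0 < quad M v.

(* [eigenvalue] refers to row eigenvectors; only symmetric matrices are used. *)
Definition is_largest_eigenvalue (R : realType) (n : nat) (M : 'M[R]_n)
    (lmax : R) : Prop :=
  eigenvalue M lmax /\ forall a : R, eigenvalue M a -> a <= lmax.

Definition subvec (R : realType) (m : nat) (I : {set 'I_m}) (v : 'cV[R]_m) :
    'cV[R]_#|I| :=
  rowsub (fun j : 'I_#|I| => enum_val j) v.

Definition submat (R : realType) (m : nat) (I : {set 'I_m}) (M : 'M[R]_m) :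
    'M[R]_#|I| :=
  mxsub (fun j : 'I_#|I| => enum_val j) (fun j : 'I_#|I| => enum_val j) M.

Definition nonneg (R : realType) (m : nat) (x : 'cV[R]_m) : Prop :=
  forall i, 0 <= x i ord0.

Definition pospart (R : realType) (m : nat) (z : 'cV[R]_m) : 'cV[R]_m :=
  \col_i Num.max 0 (z i ord0).

Definition objective (R : realType) (m : nat) (Q : 'M[R]_m) (c : 'cV[R]_m)
    (d : R) (x : 'cV[R]_m) : R :=
  quad Q x + dot c x + d.

Definition gradient (R : realType) (m : nat) (Q : 'M[R]_m) (c : 'cV[R]_m)
    (x : 'cV[R]_m) : 'cV[R]_m :=
  2 *: (Q *m x) + c.

Definition minimizer (R : realType) (m : nat) (Q : 'M[R]_m) (c : 'cV[R]_m)
    (d : R) (x : 'cV[R]_m) : Prop :=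
  nonneg x /\
  forall y : 'cV[R]_m, nonneg y -> objective Q c d x <= objective Q c d y.

Definition nonactive (R : realType) (m : nat) (Q : 'M[R]_m) (c : 'cV[R]_m)
    (eps : R) (x : 'cV[R]_m) : {set 'I_m} :=
  [set i | eps * gradient Q c x i ord0 < x i ord0].

Definition active (R : realType) (m : nat) (Q : 'M[R]_m) (c : 'cV[R]_m)
    (eps : R) (x : 'cV[R]_m) : {set 'I_m} :=
  ~: nonactive Q c eps x.

Definition xtilde (R : realType) (m : nat) (Q : 'M[R]_m) (c : 'cV[R]_m)
    (eps : R) (x : 'cV[R]_m) : 'cV[R]_m :=
  \col_i (if i \in nonactive Q c eps x then x i ord0 else 0).

(* [cg_yhat] is [None] exactly as long as the flag "check" is true. *)
Record cg_state (R : realType) (n : nat) := CGState {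
  cg_l : nat;
  cg_y : 'cV[R]_n;
  cg_g : 'cV[R]_n;
  cg_p : 'cV[R]_n;
  cg_yhat : option 'cV[R]_n
}.

Definition cg_init (R : realType) (n : nat) (g0 : 'cV[R]_n) : cg_state R n :=
  CGState 0 0 g0 (- g0) None.

Definition cg_candidate (R : realType) (n : nat) (g0 : 'cV[R]_n)
    (s : cg_state R n) : 'cV[R]_n :=
  if cg_l s is 0%N then - g0 else cg_y s.

Definition cg_record (R : realType) (n : nat) (M : 'M[R]_n) (eta : R)
    (g0 : 'cV[R]_n) (s : cg_state R n) : option 'cV[R]_n :=
  if cg_yhat s is Some y then Some y
  else if quad M (cg_p s) <= eta * dot (cg_p s) (cg_p s)
  then Some (cg_candidate g0 s) else None.

Definition cg_body (R : realType) (n : nat) (M : 'M[R]_n) (eta : R)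
    (g0 : 'cV[R]_n) (s : cg_state R n) : cg_state R n :=
  let: CGState l y g p _ := s in
  let a := dot g g / quad M p in
  let g' := g + a *: (M *m p) in
  let b := dot g' g' / dot g g in
  CGState l.+1 (y + a *: p) g' (- g' + b *: p) (cg_record M eta g0 s).

Definition cg_iter (R : realType) (n : nat) (M : 'M[R]_n) (eta : R)
    (g0 : 'cV[R]_n) (l : nat) : cg_state R n :=
  iter l (cg_body M eta g0) (cg_init g0).

(* The while loop is left after exactly [L] executions of its body. *)
Definition cg_exit (R : realType) (n : nat) (M : 'M[R]_n) (eta : R)
    (g0 : 'cV[R]_n) (L : nat) : Prop :=
  (forall l : nat, (l < L)%N -> 0 < quad M (cg_p (cg_iter M eta g0 l))) /\
  quad M (cg_p (cg_iter M eta g0 L)) <= 0.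

Definition cg_direction (R : realType) (n : nat) (g0 : 'cV[R]_n)
    (s : cg_state R n) : 'cV[R]_n :=
  odflt (cg_candidate g0 s) (cg_yhat s).

(* With M = Q_NN, the model
     phi(y) = y^T M y + g(xt)_N^T y = q(xt + y) - q(xt)   (y supported on N)
   has half-Hessian M.  The recurrences of [cg_body] use M, not 2 M, so they
   are conjugate gradients for phi provided that the vectors "g" are the
   half-gradients M y + g(xt)_N / 2.  At y = 0, and since xt vanishes off N,
   this is g(xt)_N / 2 = Q_NN xt_N + c_N / 2. *)
Definition half_gradient (R : realType) (m : nat) (Q : 'M[R]_m) (c : 'cV[R]_m)
    (N : {set 'I_m}) (xt : 'cV[R]_m) : 'cV[R]_#|N| :=
  2^-1 *: subvec N (gradient Q c xt).

(* The vectors y are displacements from xt_N, whence xbar_N = xt_N + y.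
   For Q psd and eta fixed the resulting direction is always gradient related,
   so this is not required separately. *)
Definition direction_routine (R : realType) (m : nat) (Q : 'M[R]_m)
    (c : 'cV[R]_m) (eta : R) (N : {set 'I_m}) (xt dk xbar : 'cV[R]_m) : Prop :=
  let M := submat N Q in
  let g0 := half_gradient Q c N xt in
  exists L : nat,
    let s := cg_iter M eta g0 L in
    [/\ cg_exit M eta g0 L,
        subvec (~: N) dk = 0,
        subvec N dk = cg_direction g0 s,
        subvec (~: N) xbar = 0
      & subvec N xbar = subvec N xt + cg_candidate g0 s].

Definition sufficient_decrease (R : realType) (m : nat) (Q : 'M[R]_m)
    (c : 'cV[R]_m) (d delta gamma : R) (xt dk : 'cV[R]_m) (j : nat) : Prop :=
  objective Q c d (pospart (xt + delta ^+ j *: dk)) <=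
  objective Q c d xt + gamma * delta ^+ j * dot (gradient Q c xt) dk.

Definition line_search (R : realType) (m : nat) (Q : 'M[R]_m) (c : 'cV[R]_m)
    (d delta gamma : R) (xt dk : 'cV[R]_m) (j : nat) : Prop :=
  sufficient_decrease Q c d delta gamma xt dk j /\
  forall i : nat, (i < j)%N ->
    ~ sufficient_decrease Q c d delta gamma xt dk i.

(* [Running x]: x is the current iterate; [Stopped z]: the algorithm has
   stopped and returned z. *)
Inductive status (R : realType) (m : nat) :=
  | Running of 'cV[R]_m
  | Stopped of 'cV[R]_m.

Definition status_point (R : realType) (m : nat) (s : status R m) : 'cV[R]_m :=
  match s with Running x => x | Stopped z => z end.

Inductive fastqpa_iteration (R : realType) (m : nat) (Q : 'M[R]_m)
    (c : 'cV[R]_m) (d eps delta gamma eta : R) (x : 'cV[R]_m) :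
    status R m -> Prop :=
  | Stop_iterate :
      minimizer Q c d x ->
      fastqpa_iteration Q c d eps delta gamma eta x (Stopped x)
  | Stop_xbar (dk xbar : 'cV[R]_m) :
      ~ minimizer Q c d x ->
      direction_routine Q c eta (nonactive Q c eps x) (xtilde Q c eps x)
        dk xbar ->
      minimizer Q c d xbar ->
      fastqpa_iteration Q c d eps delta gamma eta x (Stopped xbar)
  | Next_iterate (dk xbar : 'cV[R]_m) (j : nat) :
      ~ minimizer Q c d x ->
      direction_routine Q c eta (nonactive Q c eps x) (xtilde Q c eps x)
        dk xbar ->
      ~ minimizer Q c d xbar ->
      line_search Q c d delta gamma (xtilde Q c eps x) dk j ->
      fastqpa_iteration Q c d eps delta gamma eta x
        (Running (pospart (xtilde Q c eps x + delta ^+ j *: dk))).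

(* A run that stops is continued constantly, so that the sequence of points is
   infinite in all cases. *)
Definition fastqpa_run (R : realType) (m : nat) (Q : 'M[R]_m) (c : 'cV[R]_m)
    (d eps delta gamma eta : R) (x0 : 'cV[R]_m) (s : nat -> status R m) : Prop :=
  s 0%N = Running x0 /\
  forall k : nat,
    match s k with
    | Running x => fastqpa_iteration Q c d eps delta gamma eta x (s k.+1)
    | Stopped z => s k.+1 = Stopped z
    end.

Definition accumulation_point (R : realType) (m : nat) (u : nat -> 'cV[R]_m)
    (x : 'cV[R]_m) : Prop :=
  cluster (u @ \oo) x.

Definition Nhat (R : realType) (m : nat) (Q : 'M[R]_m) (c : 'cV[R]_m)
    (x : 'cV[R]_m) : {set 'I_m} :=
  [set i | 0 < x i ord0] :|:
  [set i | (x i ord0 == 0) && (gradient Q c x i ord0 == 0)].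

(* Main.v *)
Require Import Defs.
From HB Require Import structures.
From mathcomp Require Import all_boot all_order all_algebra.
From mathcomp Require Import all_classical all_reals all_analysis.
From mathcomp Require Import ring lra.

Import Order.TTheory GRing.Theory Num.Theory.
Import numFieldNormedType.Exports.

Local Open Scope classical_set_scope.
Local Open Scope ring_scope.

(** The proof combines a global convergence argument with an exact
    identification of the limit.

    Suppose that no minimizer is ever returned; then the run is an infinite
    sequence of iterates.  Write [r] for the distance from an iterate [x] to
    [xtilde] and [h] for the norm of the reduced half-gradient at [xtilde].

    Convergence.  Every iteration lowers the objective by at least
    [k * (r ^+ 2 + h ^+ 2)] with one constant [k > 0]
    ([iteration_decrease]).  Three facts give this.  Setting the estimated
    active variables to zero gains a multiple of [r ^+ 2], because [eps] is
    small with respect to the largest eigenvalue ([xtilde_decrease], which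
    needs the Rayleigh bound [symmetric_spectral_bound]).  The direction is
    gradient related with uniform constants ([direction_gradient_related]):
    it is either steepest descent, or the conjugate gradient iterate reached
    when the curvature first drops below [eta].  That iterate does at least as
    well on the model as the first, steepest descent, step, and it is the sum
    of at most [m] steps of controlled length.  Finally, projecting onto the
    orthant spoils the line search only to second order, up to a term of order
    [r] ([projected_step_bound]): so the step length is bounded below unless [r]
    dominates [h], in which case the gain in [r ^+ 2] suffices.  The objective
    is convex and decreases along the run, so it stays above its value at the
    accumulation point [xstar]; hence near [xstar] the iterates have
    arbitrarily small [r] and [h] ([accumulation_residuals]), and in the limit
    [xstar] satisfies the optimality conditions ([limit_kkt]).

    Termination.  For an iterate close enough to [xstar], the index set [N] of
    the nonactive variables contains the support of [xstar] and is contained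
    in [Nhat] ([nonactive_near]).  The matrix is positive definite on [N], so
    the conjugate gradient loop can only stop at a zero direction, that is, at
    an exact stationary point of the objective on the vectors supported on
    [N].  Strict convexity makes that point unique, and [xstar] is another
    one: the point [xbar] equals [xstar] ([direction_point_unique]).  Thus
    [xbar] is a minimizer and the algorithm stops there after all. *)

(** * Inner products and norms *)

Lemma dotE {R : realType} {n : nat} (u v : 'cV[R]_n) :
  dot u v = \sum_i u i ord0 * v i ord0.
Proof. by rewrite /dot mxE; apply: eq_bigr => i _; rewrite mxE. Qed.

Lemma dotC {R : realType} {n : nat} (u v : 'cV[R]_n) : dot u v = dot v u.
Proof. by rewrite !dotE; apply: eq_bigr => i _; rewrite mulrC. Qed.

Lemma dotDr {R : realType} {n : nat} (w u v : 'cV[R]_n) :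
  dot w (u + v) = dot w u + dot w v.
Proof. by rewrite /dot mulmxDr mxE. Qed.

Lemma dotZr {R : realType} {n : nat} (w : 'cV[R]_n) (a : R) (u : 'cV[R]_n) :
  dot w (a *: u) = a * dot w u.
Proof. by rewrite /dot -scalemxAr mxE. Qed.

Lemma dotNr {R : realType} {n : nat} (w u : 'cV[R]_n) :
  dot w (- u) = - dot w u.
Proof. by rewrite /dot mulmxN mxE. Qed.

Lemma dotDl {R : realType} {n : nat} (w u v : 'cV[R]_n) :
  dot (u + v) w = dot u w + dot v w.
Proof. by rewrite dotC dotDr !(dotC w). Qed.

Lemma dotZl {R : realType} {n : nat} (w : 'cV[R]_n) (a : R) (u : 'cV[R]_n) :
  dot (a *: u) w = a * dot u w.
Proof. by rewrite dotC dotZr (dotC w). Qed.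

Lemma dotNl {R : realType} {n : nat} (w u : 'cV[R]_n) :
  dot (- u) w = - dot u w.
Proof. by rewrite dotC dotNr (dotC w). Qed.

Lemma dot0r {R : realType} {n : nat} (w : 'cV[R]_n) : dot w 0 = 0.
Proof. by rewrite /dot mulmx0 mxE. Qed.

Lemma dot0l {R : realType} {n : nat} (w : 'cV[R]_n) : dot 0 w = 0.
Proof. by rewrite dotC dot0r. Qed.

Definition dot_lin := (@dotDl, @dotDr, @dotZl, @dotZr, @dotNl, @dotNr,
  @dot0l, @dot0r).

Lemma dot_ge0 {R : realType} {n : nat} (u : 'cV[R]_n) : 0 <= dot u u.
Proof. by rewrite dotE; apply: sumr_ge0 => i _; rewrite -expr2 sqr_ge0. Qed.

Lemma dot_ge_coord {R : realType} {n : nat} (u : 'cV[R]_n) i :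
  u i ord0 ^+ 2 <= dot u u.
Proof.
rewrite dotE (bigD1 i) //= -expr2 lerDl.
by apply: sumr_ge0 => j _; rewrite -expr2 sqr_ge0.
Qed.

Lemma dot_eq0 {R : realType} {n : nat} (u : 'cV[R]_n) :
  dot u u = 0 -> u = 0.
Proof.
move=> u0; apply/matrixP => i j; rewrite (ord1 j) mxE; apply/eqP.
rewrite -sqrf_eq0; apply/eqP/le_anti; rewrite sqr_ge0 andbT.
by rewrite -u0 dot_ge_coord.
Qed.

Lemma dot_gt0 {R : realType} {n : nat} (u : 'cV[R]_n) :
  u != 0 -> 0 < dot u u.
Proof.
move=> u0; rewrite lt_def dot_ge0 andbT.
by apply: contraNneq u0 => /dot_eq0 ->.
Qed.

(** The Euclidean norm; [`|u|] would be the maximum norm of the coordinates. *)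
Definition nrm {R : realType} {n : nat} (u : 'cV[R]_n) : R :=
  Num.sqrt (dot u u).

Lemma nrm_ge0 {R : realType} {n : nat} (u : 'cV[R]_n) : 0 <= nrm u.
Proof. exact: sqrtr_ge0. Qed.

Lemma nrm_sqr {R : realType} {n : nat} (u : 'cV[R]_n) :
  nrm u ^+ 2 = dot u u.
Proof. by rewrite sqr_sqrtr // dot_ge0. Qed.

Lemma nrmZ {R : realType} {n : nat} (a : R) (u : 'cV[R]_n) :
  nrm (a *: u) = `|a| * nrm u.
Proof.
by rewrite /nrm !dot_lin mulrA -expr2 sqrtrM ?sqr_ge0 // sqrtr_sqr.
Qed.

Lemma nrmN {R : realType} {n : nat} (u : 'cV[R]_n) : nrm (- u) = nrm u.
Proof. by rewrite /nrm !dot_lin opprK. Qed.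

Lemma nrm0 {R : realType} {n : nat} : nrm (0 : 'cV[R]_n) = 0.
Proof. by rewrite /nrm dot0r sqrtr0. Qed.

Lemma coord_le_nrm {R : realType} {n : nat} (u : 'cV[R]_n) i :
  `|u i ord0| <= nrm u.
Proof. by rewrite -sqrtr_sqr ler_wsqrtr // dot_ge_coord. Qed.

(** A quadratic with nonnegative values has nonpositive discriminant; this is
    the source of both Cauchy-Schwarz inequalities below. *)
Lemma discriminant_le {R : realType} (a b c : R) :
  0 <= a -> (forall t, 0 <= a * t ^+ 2 + 2 * b * t + c) -> b ^+ 2 <= a * c.
Proof.
move=> a0 H; have [a_eq0|a_neq0] := eqVneq a 0.
  rewrite a_eq0 mul0r; have [->|b0] := eqVneq b 0; first by rewrite expr0n.
  have := H (- (c + 1) / (2 * b)); rewrite a_eq0 mul0r add0r.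
  have -> : 2 * b * (- (c + 1) / (2 * b)) + c = -1 by field.
  by rewrite ler0N1.
have a_gt0 : 0 < a by rewrite lt_def a_neq0.
have := H (- b / a).
have -> : a * (- b / a) ^+ 2 + 2 * b * (- b / a) + c = (a * c - b ^+ 2) / a.
  by field.
by rewrite pmulr_lge0 ?invr_gt0 // subr_ge0.
Qed.

Lemma dot_sqr_le {R : realType} {n : nat} (u v : 'cV[R]_n) :
  dot u v ^+ 2 <= dot u u * dot v v.
Proof.
apply: discriminant_le; first exact: dot_ge0.
move=> t; have := dot_ge0 (t *: u + v); rewrite !dot_lin (dotC v u).
by congr (_ <= _); ring.
Qed.

Lemma dot_le_nrm {R : realType} {n : nat} (u v : 'cV[R]_n) :
  `|dot u v| <= nrm u * nrm v.
Proof.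
rewrite -[leLHS]ger0_norm // -ler_sqr ?nnegrE ?mulr_ge0 ?nrm_ge0 //.
by rewrite normr_id exprMn !nrm_sqr real_normK ?num_real // dot_sqr_le.
Qed.

Lemma nrmD {R : realType} {n : nat} (u v : 'cV[R]_n) :
  nrm (u + v) <= nrm u + nrm v.
Proof.
rewrite -ler_sqr ?nnegrE ?addr_ge0 ?nrm_ge0 //.
rewrite nrm_sqr !dot_lin (dotC v u) sqrrD !nrm_sqr.
have := le_trans (ler_norm _) (dot_le_nrm u v); lra.
Qed.

Lemma nrm_mono {R : realType} {n : nat} (u v : 'cV[R]_n) :
  (forall i, `|u i ord0| <= `|v i ord0|) -> nrm u <= nrm v.
Proof.
move=> uv; apply: ler_wsqrtr; rewrite !dotE; apply: ler_sum => i _.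
rewrite -!expr2 -(real_normK (num_real (u i _))).
by rewrite -(real_normK (num_real (v i _))) ler_sqr ?nnegrE.
Qed.

Lemma nrm_le_sum {R : realType} {n : nat} (u : 'cV[R]_n) :
  nrm u <= \sum_i `|u i ord0|.
Proof.
have s0 : 0 <= \sum_i `|u i ord0| by apply: sumr_ge0.
rewrite -ler_sqr ?nnegrE ?nrm_ge0 // nrm_sqr dotE expr2 mulr_suml.
apply: ler_sum => i _; rewrite (le_trans (ler_norm _)) // normrM.
apply: ler_wpM2l => //; rewrite (bigD1 i) //= lerDl.
exact: sumr_ge0.
Qed.

(** * Positive semidefinite quadratic forms *)

Lemma quadE {R : realType} {n : nat} (M : 'M[R]_n) (v : 'cV[R]_n) :
  quad M v = dot v (M *m v).
Proof. by rewrite /quad /dot mulmxA. Qed.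

Lemma dot_mulmx {R : realType} {n k : nat} (M : 'M[R]_(n, k)) u v :
  dot u (M *m v) = dot (M^T *m u) v.
Proof. by rewrite /dot trmx_mul trmxK mulmxA. Qed.

Lemma dot_sym {R : realType} {n : nat} (M : 'M[R]_n) u v :
  M^T = M -> dot u (M *m v) = dot v (M *m u).
Proof. by move=> symM; rewrite dot_mulmx symM dotC. Qed.

Lemma quadD {R : realType} {n : nat} (M : 'M[R]_n) u v :
  M^T = M -> quad M (u + v) = quad M u + 2 * dot u (M *m v) + quad M v.
Proof.
by move=> symM; rewrite !quadE mulmxDr !dot_lin (dot_sym _ v u) //; ring.
Qed.

Lemma quadZ {R : realType} {n : nat} (M : 'M[R]_n) (a : R) u :
  quad M (a *: u) = a ^+ 2 * quad M u.
Proof. by rewrite !quadE -scalemxAr !dot_lin; ring. Qed.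

Lemma quadN {R : realType} {n : nat} (M : 'M[R]_n) u :
  quad M (- u) = quad M u.
Proof. by rewrite !quadE mulmxN !dot_lin opprK. Qed.

Lemma quad0 {R : realType} {n : nat} (M : 'M[R]_n) : quad M 0 = 0.
Proof. by rewrite quadE dot0l. Qed.

Lemma psd_cauchy_schwarz {R : realType} {n : nat} (M : 'M[R]_n) u v :
  psd M -> dot u (M *m v) ^+ 2 <= quad M u * quad M v.
Proof.
move=> [symM psdM]; apply: discriminant_le; first exact: psdM.
move=> t; have := psdM (t *: u + v); rewrite quadD // quadZ !dot_lin.
by congr (_ <= _); ring.
Qed.

(** Cauchy-Schwarz for the form [M], applied to [M *m u] and [u]. *)
Lemma psd_mulmx_sqr_le {R : realType} {n : nat} (M : 'M[R]_n) (L : R) u :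
  psd M -> (forall v, quad M v <= L * dot v v) ->
  dot (M *m u) (M *m u) <= L * quad M u.
Proof.
move=> psdM hL; have [->|Mu0] := eqVneq (M *m u) 0.
  rewrite dot0l; have := psdM.2 u; have := hL u; have := dot_ge0 u.
  rewrite le_eqVlt => /orP[/eqP|] u0 h1 h2.
    by rewrite (dot_eq0 _ (esym u0)) quad0 mulr0.
  apply: mulr_ge0 => //; have := le_trans h2 h1.
  by rewrite pmulr_lge0.
have d0 := dot_gt0 _ Mu0.
rewrite -(ler_pM2l d0) -expr2.
apply: le_trans (psd_cauchy_schwarz _ (M *m u) u psdM) _.
rewrite mulrA (mulrC _ L).
by apply: ler_wpM2r; [exact: psdM.2|exact: hL].
Qed.

Lemma nrm_mulmx_le {R : realType} {n : nat} (M : 'M[R]_n) (L : R) u :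
  0 <= L -> psd M -> (forall v, quad M v <= L * dot v v) ->
  nrm (M *m u) <= L * nrm u.
Proof.
move=> L0 psdM hL; rewrite -ler_sqr ?nnegrE ?mulr_ge0 ?nrm_ge0 //.
rewrite exprMn !nrm_sqr (le_trans (psd_mulmx_sqr_le _ _ u psdM hL)) //.
by rewrite expr2 -mulrA ler_wpM2l.
Qed.

Lemma quad_le_sum {R : realType} {n : nat} (M : 'M[R]_n) v :
  quad M v <= (\sum_i \sum_j `|M i j|) * dot v v.
Proof.
rewrite quadE dotE mulr_suml; apply: ler_sum => i _.
rewrite mxE mulr_sumr mulr_suml; apply: ler_sum => j _.
apply: le_trans (ler_norm _) _; rewrite mulrCA normrM.
apply: ler_wpM2l => //; rewrite normrM -nrm_sqr expr2.
by apply: ler_pM => //; apply: coord_le_nrm.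
Qed.

(** The supremum of the Rayleigh quotients is itself an eigenvalue. *)
Lemma symmetric_spectral_bound {R : realType} {n : nat} (M : 'M[R]_n) (l : R) :
  M^T = M -> is_largest_eigenvalue M l -> forall v, quad M v <= l * dot v v.
Proof.
move=> symM [eig_l max_l].
pose S := [set quad M v / dot v v | v in [set v : 'cV[R]_n | v != 0]].
have [w w0] : exists w : 'cV[R]_n, w != 0.
  have /eigenvalueP[r _ r0] := eig_l; exists r^T.
  by apply: contra r0 => /eqP r0; rewrite -[r]trmxK r0 trmx0.
have bndS : has_ubound S.
  exists (\sum_i \sum_j `|M i j|) => _ [v v0 <-].
  by rewrite ler_pdivrMr ?dot_gt0 // quad_le_sum.
have neS : S !=set0 by exists (quad M w / dot w w), w.
pose mu := sup S.
have quad_mu v : quad M v <= mu * dot v v.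
  have [->|v0] := eqVneq v 0; first by rewrite quad0 dot0l mulr0.
  by rewrite -ler_pdivrMr ?dot_gt0 // ub_le_sup //; exists v.
suff mu_eig : eigenvalue M mu.
  move=> v; apply: le_trans (quad_mu v) _.
  by apply: ler_wpM2r; [exact: dot_ge0|exact: max_l].
pose B := mu%:M - M.
have quadB v : quad B v = mu * dot v v - quad M v.
  by rewrite !quadE /B mulmxBl mul_scalar_mx dotDr dotNr dotZr.
have psdB : psd B.
  split; first by rewrite /B linearB /= tr_scalar_mx symM.
  by move=> v; rewrite quadB subr_ge0.
suff nB : B \notin unitmx.
  rewrite /eigenvalue /eigenspace kermx_eq0 row_free_unit.
  by rewrite -opprB -scaleN1r unitmxZ ?unitrN1.
apply/negP => uB.
(* If B were invertible it would be bounded below by a positive multiple of the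
   identity, so a number below mu would still bound the Rayleigh quotients. *)
pose C := 1 + \sum_i \sum_j `|invmx B i j|.
have C0 : 0 < C.
  by apply: ltr_wpDr => //; apply: sumr_ge0 => i _; apply: sumr_ge0.
have lowB v : dot v v <= C * quad B v.
  have := psd_cauchy_schwarz _ v (invmx B *m v) psdB.
  rewrite [quad B (_ *m _)]quadE mulmxA mulmxV // mul1mx (dotC _ v) -quadE.
  have [->|v0] := eqVneq v 0; first by rewrite quad0 dot0l mulr0.
  have d0 := dot_gt0 _ v0; have q0 := psdB.2 v => h.
  rewrite -(ler_pM2l d0) -expr2 (le_trans h) // mulrA [leRHS]mulrC.
  apply: ler_wpM2l => //; apply: le_trans (quad_le_sum _ _) _.
  by rewrite mulrC; apply: ler_wpM2l; [exact: ltW|rewrite lerDr].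
have : mu <= mu - C^-1.
  apply: ge_sup => // _ [v v0 <-].
  rewrite ler_pdivrMr ?dot_gt0 // mulrBl.
  have := lowB v; rewrite -ler_pdivrMl // quadB; lra.
by rewrite lerBrDr gerDl leNgt invr_gt0 C0.
Qed.

(** * Vectors supported on an index set *)

Definition supported {R : realType} {m : nat} (N : {set 'I_m})
    (v : 'cV[R]_m) : Prop :=
  forall i, i \notin N -> v i ord0 = 0.

(** Restricting to [N] is multiplication by this matrix, and its transpose
    pads with zeros, so that subvectors and principal submatrices obey the
    rules of matrix products. *)
Definition selection {R : realType} {m : nat} (N : {set 'I_m}) :
    'M[R]_(#|N|, m) :=
  rowsub (fun j : 'I_#|N| => enum_val j) 1%:M.

Definition extend {R : realType} {m : nat} (N : {set 'I_m})
    (y : 'cV[R]_#|N|) : 'cV[R]_m :=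
  (selection N)^T *m y.

Lemma subvecE {R : realType} {m : nat} (N : {set 'I_m}) (v : 'cV[R]_m) :
  subvec N v = selection N *m v.
Proof. by rewrite /subvec /selection mul_rowsub_mx mul1mx. Qed.

Lemma submatE {R : realType} {m : nat} (N : {set 'I_m}) (M : 'M[R]_m) :
  submat N M = selection N *m M *m (selection N)^T.
Proof.
rewrite /selection mul_rowsub_mx mul1mx.
apply/matrixP => i j; rewrite !mxE.
rewrite (bigD1 (enum_val j)) //= !mxE eqxx mulr1 big1 ?addr0 // => k kj.
by rewrite !mxE eq_sym (negbTE kj) mulr0.
Qed.

Lemma subvecD {R : realType} {m : nat} (N : {set 'I_m}) (u v : 'cV[R]_m) :
  subvec N (u + v) = subvec N u + subvec N v.
Proof. by rewrite !subvecE mulmxDr. Qed.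

Lemma subvecZ {R : realType} {m : nat} (N : {set 'I_m}) (a : R)
    (v : 'cV[R]_m) :
  subvec N (a *: v) = a *: subvec N v.
Proof. by rewrite !subvecE scalemxAr. Qed.

Lemma subvec_coord {R : realType} {m : nat} (N : {set 'I_m}) (v : 'cV[R]_m)
    i (iN : i \in N) :
  v i ord0 = subvec N v (enum_rank_in iN i) ord0.
Proof. by rewrite mxE enum_rankK_in. Qed.

Lemma supportedB {R : realType} {m : nat} (N : {set 'I_m})
    (u v : 'cV[R]_m) :
  supported N u -> supported N v -> supported N (u - v).
Proof. by move=> su sv i iN; rewrite !mxE su // sv // subrr. Qed.

Lemma supported_subset {R : realType} {m : nat} (N N' : {set 'I_m})
    (v : 'cV[R]_m) :
  N \subset N' -> supported N v -> supported N' v.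
Proof.
by move=> /fintype.subsetP NN' sv i iN'; apply: sv; apply: contra iN' => /NN'.
Qed.

Lemma subvecB {R : realType} {m : nat} (N : {set 'I_m}) (u v : 'cV[R]_m) :
  subvec N (u - v) = subvec N u - subvec N v.
Proof. by rewrite subvecD -scaleN1r subvecZ scaleN1r. Qed.

Lemma subvec_setC0 {R : realType} {m : nat} (N : {set 'I_m})
    (v : 'cV[R]_m) :
  subvec (~: N) v = 0 -> supported N v.
Proof.
move=> v0 i iN; have iC : i \in ~: N by rewrite inE.
by rewrite (subvec_coord _ _ _ iC) v0 mxE.
Qed.

Lemma subvec_eq0 {R : realType} {m : nat} (N : {set 'I_m}) (v : 'cV[R]_m) :
  supported N v -> subvec N v = 0 -> v = 0.
Proof.
move=> supp_v v0; apply/matrixP => i j; rewrite (ord1 j) mxE.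
have [iN|/supp_v//] := boolP (i \in N).
by rewrite (subvec_coord _ _ _ iN) v0 mxE.
Qed.

Lemma dot_subvec {R : realType} {m : nat} (N : {set 'I_m})
    (u v : 'cV[R]_m) :
  supported N v -> dot u v = dot (subvec N u) (subvec N v).
Proof.
move=> supp_v; rewrite !dotE (bigID (mem N)) /= [X in _ + X]big1.
  rewrite addr0 (big_enum_val (fun i => u i ord0 * v i ord0)) /=.
  by apply: eq_bigr => j _; rewrite !mxE.
by move=> i /supp_v ->; rewrite mulr0.
Qed.

Lemma nrm_subvec {R : realType} {m : nat} (N : {set 'I_m}) (v : 'cV[R]_m) :
  supported N v -> nrm v = nrm (subvec N v).
Proof. by move=> supp_v; rewrite /nrm (dot_subvec N). Qed.

Lemma supported_extend {R : realType} {m : nat} (N : {set 'I_m})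
    (y : 'cV[R]_#|N|) :
  supported N (extend N y).
Proof.
move=> i iN; rewrite mxE big1 // => j _; rewrite !mxE.
have -> : (enum_val j == i) = false.
  by apply: contraNF iN => /eqP <-; exact: enum_valP.
by rewrite mul0r.
Qed.

Lemma subvec_extend {R : realType} {m : nat} (N : {set 'I_m})
    (y : 'cV[R]_#|N|) :
  subvec N (extend N y) = y.
Proof.
rewrite subvecE /extend mulmxA.
have -> : selection N *m (selection N)^T = 1%:M :> 'M[R]_#|N|.
  rewrite -(mul1mx (selection N)^T) mulmxA -submatE; apply/matrixP => i j.
  by rewrite !mxE (inj_eq enum_val_inj).
by rewrite mul1mx.
Qed.

Lemma extend_subvec {R : realType} {m : nat} (N : {set 'I_m})
    (v : 'cV[R]_m) :
  supported N v -> extend N (subvec N v) = v.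
Proof.
move=> supp_v; apply/eqP; rewrite -subr_eq0; apply/eqP.
apply: (subvec_eq0 N); last first.
  by rewrite subvecB subvec_extend subrr.
by apply: supportedB => //; exact: supported_extend.
Qed.

Lemma mulmx_subvec {R : realType} {m : nat} (N : {set 'I_m}) (M : 'M[R]_m)
    (v : 'cV[R]_m) :
  supported N v -> submat N M *m subvec N v = subvec N (M *m v).
Proof.
move=> supp_v; rewrite -[in RHS](extend_subvec _ _ supp_v).
by rewrite submatE !subvecE /extend !mulmxA.
Qed.

Lemma quad_submat {R : realType} {m : nat} (N : {set 'I_m}) (M : 'M[R]_m)
    (v : 'cV[R]_m) :
  supported N v -> quad (submat N M) (subvec N v) = quad M v.
Proof.
move=> supp_v; rewrite !quadE mulmx_subvec // dotC -(dot_subvec N) //.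
exact: dotC.
Qed.

Lemma submat_sym {R : realType} {m : nat} (N : {set 'I_m}) (M : 'M[R]_m) :
  M^T = M -> (submat N M)^T = submat N M.
Proof. by move=> symM; rewrite /submat trmx_mxsub symM. Qed.

Lemma submat_psd {R : realType} {m : nat} (N : {set 'I_m}) (M : 'M[R]_m) :
  psd M -> psd (submat N M).
Proof.
move=> [symM psdM]; split; first exact: submat_sym.
move=> y; rewrite -(subvec_extend N y) quad_submat //.
exact: supported_extend.
Qed.

Lemma submat_quad_le {R : realType} {m : nat} (N : {set 'I_m}) (M : 'M[R]_m)
    (L : R) :
  (forall v, quad M v <= L * dot v v) ->
  forall y, quad (submat N M) y <= L * dot y y.
Proof.
move=> hL y; rewrite -(subvec_extend N y) quad_submat ?(dot_subvec N) //.
  by rewrite -(dot_subvec N) //; exact: supported_extend.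
exact: supported_extend.
Qed.

Lemma posdef_supported {R : realType} {m : nat} (N : {set 'I_m})
    (M : 'M[R]_m) (v : 'cV[R]_m) :
  posdef (submat N M) -> supported N v -> quad M v <= 0 -> v = 0.
Proof.
move=> [_ pdM] supp_v; rewrite -(quad_submat N) // => qv.
apply: (subvec_eq0 N) => //; apply/eqP/negPn/negP => /pdM.
by rewrite ltNge qv.
Qed.

(** * The conjugate gradient recurrence *)

(** The flag and the recorded direction of the routine do not influence the
    three vector sequences, which are studied here on their own. *)
Record cg_recurrence {R : realType} {n : nat} (M : 'M[R]_n) (g0 : 'cV[R]_n)
    (y g p : nat -> 'cV[R]_n) : Prop := CGRecurrence {
  cg_y0 : y 0%N = 0;
  cg_g0 : g 0%N = g0;
  cg_p0 : p 0%N = - g0;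
  cg_yS : forall l,
    y l.+1 = y l + (dot (g l) (g l) / quad M (p l)) *: p l;
  cg_gS : forall l,
    g l.+1 = g l + (dot (g l) (g l) / quad M (p l)) *: (M *m p l);
  cg_pS : forall l,
    p l.+1 = - g l.+1
             + (dot (g l.+1) (g l.+1) / dot (g l) (g l)) *: p l
}.

Lemma cg_iter_recurrence {R : realType} {n : nat} (M : 'M[R]_n) (eta : R)
    (g0 : 'cV[R]_n) :
  cg_recurrence M g0 (fun l => cg_y (cg_iter M eta g0 l))
    (fun l => cg_g (cg_iter M eta g0 l)) (fun l => cg_p (cg_iter M eta g0 l)).
Proof.
by split=> // l; rewrite /cg_iter iterS; case: (iter l _ _) => ? ? ? ? ?.
Qed.

Lemma cg_l_iter {R : realType} {n : nat} (M : 'M[R]_n) (eta : R)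
    (g0 : 'cV[R]_n) l :
  cg_l (cg_iter M eta g0 l) = l.
Proof.
elim: l => // l; rewrite /cg_iter iterS.
by case: (iter l _ _) => ? ? ? ? ? /= ->.
Qed.

Lemma cg_residual {R : realType} {n : nat} {M : 'M[R]_n} {g0 y g p} l :
  cg_recurrence M g0 y g p -> g l = g0 + M *m y l.
Proof.
move=> H; elim: l => [|l IH]; first by rewrite (cg_y0 _ _ _ _ _ H)
  (cg_g0 _ _ _ _ _ H) mulmx0 addr0.
rewrite (cg_gS _ _ _ _ _ H) (cg_yS _ _ _ _ _ H) mulmxDr addrA -IH.
by rewrite scalemxAr.
Qed.

(** The exact step length makes each new residual orthogonal to the direction
    just used, so the momentum term does not change the slope. *)
Lemma cg_slope {R : realType} {n : nat} {M : 'M[R]_n} {g0 y g p} l :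
  cg_recurrence M g0 y g p -> (forall i, (i < l)%N -> 0 < quad M (p i)) ->
  dot (p l) (g l) = - dot (g l) (g l).
Proof.
move=> H; elim: l => [|l IH] pos.
  by rewrite (cg_p0 _ _ _ _ _ H) (cg_g0 _ _ _ _ _ H) dotNl.
have pl : quad M (p l) != 0 by rewrite gt_eqF // pos.
have orth : dot (p l) (g l.+1) = 0.
  rewrite (cg_gS _ _ _ _ _ H) dotDr dotZr -quadE IH ?divfK ?addNr //.
  by move=> i il; apply: pos; exact: ltnW.
by rewrite (cg_pS _ _ _ _ _ H) dotDl dotZl orth mulr0 addr0 dotNl.
Qed.

Lemma cg_g_neq0 {R : realType} {n : nat} {M : 'M[R]_n} {g0 y g p} l :
  cg_recurrence M g0 y g p -> 0 < quad M (p l) -> g l != 0.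
Proof.
move=> H pl; apply: contraTneq pl => gl; rewrite -leNgt.
suff -> : p l = 0 by rewrite quad0.
case: l gl => [|l] gl.
  by rewrite (cg_p0 _ _ _ _ _ H) -(cg_g0 _ _ _ _ _ H) gl oppr0.
by rewrite (cg_pS _ _ _ _ _ H) gl dot0l mul0r scale0r oppr0 addr0.
Qed.

(** By the slope identity a vanishing direction forces a vanishing residual. *)
Lemma cg_p_eq0 {R : realType} {n : nat} {M : 'M[R]_n} {g0 y g p} l :
  cg_recurrence M g0 y g p -> (forall i, (i < l)%N -> 0 < quad M (p i)) ->
  p l = 0 -> g l = 0.
Proof.
move=> H pos pl; apply: dot_eq0.
by have := cg_slope l H pos; rewrite pl dot0l => /eqP; rewrite eq_sym
  oppr_eq0 => /eqP.
Qed.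

(** Orthogonality of the residuals and conjugacy of the directions support each
    other: [g i] is a combination of [p i] and [p i.-1], and [M *m p i] is a
    multiple of [g i.+1 - g i]. *)
Lemma cg_orthogonality {R : realType} {n : nat} {M : 'M[R]_n} {g0 y g p} k :
  cg_recurrence M g0 y g p -> M^T = M ->
  (forall i, (i < k)%N -> 0 < quad M (p i)) ->
  forall i, (i < k)%N -> dot (g k) (g i) = 0 /\ dot (p k) (M *m p i) = 0.
Proof.
move=> H symM; elim: k => [//|k IH] pos.
have {}IH := IH (fun i ik => pos i (ltnW ik)).
have gk0 : dot (g k) (g k) != 0.
  by rewrite gt_eqF // dot_gt0 // (cg_g_neq0 _ H) // pos.
have pk0 : quad M (p k) != 0 by rewrite gt_eqF // pos.
have conj_g i : (i <= k)%N ->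
    dot (p k) (M *m g i) = - dot (p k) (M *m p i).
  case: i => [|i] ik.
    by rewrite (cg_p0 _ _ _ _ _ H) (cg_g0 _ _ _ _ _ H) mulmxN dotNr opprK.
  have -> : g i.+1 = - p i.+1
      + (dot (g i.+1) (g i.+1) / dot (g i) (g i)) *: p i.
    by rewrite (cg_pS _ _ _ _ _ H) opprD opprK subrK.
  by rewrite mulmxDr -scalemxAr mulmxN !dot_lin (IH _ ik).2 mulr0 addr0.
have orth i : (i <= k)%N -> dot (g k.+1) (g i) = 0.
  move=> ik; rewrite (cg_gS _ _ _ _ _ H) dotDl dotZl dotC.
  rewrite (dotC (M *m _)) (dot_sym _ _ _ symM) conj_g //.
  move: ik; rewrite leq_eqVlt => /orP[/eqP ->|ik].
    by rewrite -quadE mulrN divfK // subrr.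
  by rewrite (IH _ ik).2 dotC (IH _ ik).1 oppr0 mulr0 addr0.
move=> i ik; split; first exact: orth.
have gi0 : dot (g i) (g i) != 0.
  by rewrite gt_eqF // dot_gt0 // (cg_g_neq0 _ H) // pos.
have pi0 : quad M (p i) != 0 by rewrite gt_eqF // pos.
have Mpi : M *m p i =
    (quad M (p i) / dot (g i) (g i)) *: (g i.+1 - g i).
  rewrite (cg_gS _ _ _ _ _ H) addrC addKr scalerA mulrA divfK //.
  by rewrite divff // scale1r.
rewrite (cg_pS _ _ _ _ _ H) dotDl dotNl dotZl.
move: ik; rewrite ltnS leq_eqVlt => /orP[/eqP ik|ik].
  move: Mpi gi0 pi0; rewrite ik => Mpi gi0 pi0.
  rewrite -quadE Mpi dotZr dotDr dotNr (orth k) // subr0.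
  by field; rewrite gi0.
rewrite (IH _ ik).2 mulr0 addr0 Mpi dotZr dotDr dotNr.
by rewrite (orth _ ik) (orth _ (ltnW ik)) subrr mulr0 oppr0.
Qed.

Lemma orthogonal_family_leq {R : realType} {n L : nat}
    (v : 'I_L -> 'cV[R]_n) :
  (forall i, v i != 0) -> (forall i j, i != j -> dot (v i) (v j) = 0) ->
  (L <= n)%N.
Proof.
move=> v0 orth.
pose G : 'M[R]_(L, n) := \matrix_(i, j) v i j ord0.
have GG : G *m G^T = diag_mx (\row_i dot (v i) (v i)).
  apply/matrixP => i j; rewrite !mxE.
  transitivity (dot (v i) (v j)).
    by rewrite dotE; apply: eq_bigr => k _; rewrite !mxE.
  have [->|ij] := eqVneq i j; first by rewrite mulr1n.
  by rewrite orth // mulr0n.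
have /mxrank_unit <- : G *m G^T \in unitmx.
  rewrite GG unitmxE det_diag unitfE; apply/prodf_neq0 => i _.
  by rewrite mxE gt_eqF // dot_gt0.
exact: leq_trans (mxrankM_maxl _ _) (rank_leq_col _).
Qed.

(** Residuals at nonterminal steps are nonzero and pairwise orthogonal. *)
Lemma cg_steps_leq {R : realType} {n : nat} {M : 'M[R]_n} {g0 y g p} L :
  cg_recurrence M g0 y g p -> M^T = M ->
  (forall i, (i < L)%N -> 0 < quad M (p i)) -> (L <= n)%N.
Proof.
move=> H symM pos.
apply: (@orthogonal_family_leq R n L (fun i => g i)) => [i|i j].
  by apply: (cg_g_neq0 _ H); exact: pos.
wlog ij : i j / (i < j)%N => [hw|_].
  move=> ij0; have := ij0; rewrite -val_eqE neq_ltn => /orP[] ij.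
    exact: hw.
  by rewrite dotC; apply: hw => //; rewrite eq_sym.
rewrite dotC; have := @cg_orthogonality _ _ _ _ _ _ _ j H symM.
by case/(_ (fun k kj => pos _ (ltn_trans kj (ltn_ord j))) i ij).
Qed.

(** The exact line searches never increase the model [quad M y + 2 g0 y], and
    the first one, along the steepest descent direction, already gains
    [|g0|^2 / L]. *)
Lemma cg_model_decrease {R : realType} {n : nat} {M : 'M[R]_n} {g0 y g p}
    (L : R) l :
  cg_recurrence M g0 y g p -> M^T = M ->
  0 < L -> (forall v, quad M v <= L * dot v v) ->
  (forall i, (i <= l)%N -> 0 < quad M (p i)) ->
  quad M (y l.+1) + 2 * dot g0 (y l.+1) <= - (dot g0 g0 / L).
Proof.
move=> H symM L0 hL.
have step i : (forall j, (j <= i)%N -> 0 < quad M (p j)) ->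
    quad M (y i.+1) + 2 * dot g0 (y i.+1) =
    quad M (y i) + 2 * dot g0 (y i) - dot (g i) (g i) ^+ 2 / quad M (p i).
  move=> pos; have pi0 : quad M (p i) != 0 by rewrite gt_eqF // pos.
  have := cg_slope i H (fun j ji => pos _ (ltnW ji)).
  rewrite {1}(cg_residual i H) dotDr (dotC _ g0) => slope.
  rewrite (cg_yS _ _ _ _ _ H) quadD // dotDr dotZr -scalemxAr dotZr quadZ.
  rewrite (dot_sym _ _ _ symM).
  have -> : dot (p i) (M *m y i) = - dot (g i) (g i) - dot g0 (p i).
    by rewrite -slope addrC addKr.
  by field.
elim: l => [|l IH] pos; rewrite step //; last first.
  apply: le_trans (IH (fun i il => pos _ (leqW il))).
  by rewrite gerDl oppr_le0 divr_ge0 ?sqr_ge0 // ltW // pos.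
rewrite (cg_y0 _ _ _ _ _ H) quad0 dot0r mulr0 add0r (cg_g0 _ _ _ _ _ H).
have := pos 0%N (leqnn _); rewrite (cg_p0 _ _ _ _ _ H) quadN => q0.
rewrite sub0r lerN2 ler_pdivrMr // mulrAC ler_pdivlMr // expr2 -mulrA.
by apply: ler_wpM2l; rewrite ?dot_ge0 // mulrC.
Qed.

(** As long as the curvature along the directions stays above [eta], each step
    is at most [|g l| / eta] long. *)
Lemma cg_growth {R : realType} {n : nat} {M : 'M[R]_n} {g0 y g p}
    (L eta : R) l :
  cg_recurrence M g0 y g p -> psd M ->
  0 < L -> (forall v, quad M v <= L * dot v v) -> 0 < eta ->
  (forall i, (i < l)%N -> eta * dot (p i) (p i) < quad M (p i)) ->
  nrm (g l) <= (1 + L / eta) ^+ l * nrm g0 /\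
  nrm (y l) <= l%:R * ((1 + L / eta) ^+ l / eta) * nrm g0.
Proof.
move=> H psdM L0 hL eta0; elim: l => [|l IH] curv.
  rewrite (cg_y0 _ _ _ _ _ H) (cg_g0 _ _ _ _ _ H) nrm0 expr0 mul1r.
  by rewrite !mul0r.
have [gl yl] := IH (fun i il => curv _ (leqW il)).
have pos i : (i <= l)%N -> 0 < quad M (p i).
  move=> il; apply: le_lt_trans (curv i il).
  by rewrite mulr_ge0 ?dot_ge0 // ltW.
have gp : nrm (g l) <= nrm (p l).
  have [->|g_neq0] := eqVneq (nrm (g l)) 0; first exact: nrm_ge0.
  have g_gt0 : 0 < nrm (g l) by rewrite lt_def g_neq0 nrm_ge0.
  have := dot_le_nrm (p l) (g l).
  rewrite (cg_slope l H (fun j jl => pos _ (ltnW jl))) normrN.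
  by rewrite ger0_norm ?dot_ge0 // -nrm_sqr expr2 ler_pM2r.
set a := dot (g l) (g l) / quad M (p l).
have a0 : 0 <= a by rewrite divr_ge0 ?dot_ge0 // ltW // pos.
have ap : a * nrm (p l) <= nrm (g l) / eta.
  rewrite /a mulrAC ler_pdivrMr ?pos // mulrAC ler_pdivlMr //.
  rewrite -nrm_sqr expr2 -!mulrA ler_wpM2l ?nrm_ge0 //.
  apply: le_trans (ltW (curv l (leqnn _))).
  rewrite -nrm_sqr expr2 mulrA mulrC ler_wpM2l ?(ltW eta0) //.
  by rewrite ler_wpM2r ?nrm_ge0.
set K := 1 + L / eta in gl yl *.
have K1 : 1 <= K by rewrite lerDl divr_ge0 // ltW.
have K0 : 0 <= K by apply: le_trans K1.
split.
  rewrite (cg_gS _ _ _ _ _ H) (le_trans (nrmD _ _)) // nrmZ ger0_norm //.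
  have h1 := nrm_mulmx_le M L (p l) (ltW L0) psdM hL.
  have h2 : a * nrm (M *m p l) <= L / eta * nrm (g l).
    apply: le_trans (ler_wpM2l a0 h1) _.
    by rewrite mulrCA -mulrA ler_wpM2l ?(ltW L0) // [leRHS]mulrC.
  apply: (@le_trans _ _ (K * nrm (g l))).
    by rewrite /K mulrDl mul1r lerD2l.
  by rewrite exprS -mulrA ler_wpM2l.
rewrite (cg_yS _ _ _ _ _ H) (le_trans (nrmD _ _)) // nrmZ ger0_norm //.
have KS : K ^+ l <= K ^+ l.+1 by rewrite exprS ler_peMl // exprn_ge0.
have ieta : 0 <= eta^-1 by rewrite invr_ge0 ltW.
have KSe : K ^+ l / eta <= K ^+ l.+1 / eta by rewrite ler_wpM2r.
rewrite -natr1 mulrDl mul1r mulrDl; apply: lerD.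
  apply: le_trans yl _; rewrite ler_wpM2r ?nrm_ge0 //.
  by rewrite ler_wpM2l.
apply: le_trans ap _; apply: (@le_trans _ _ (K ^+ l / eta * nrm g0)).
  by rewrite [leRHS]mulrAC ler_wpM2r.
by rewrite ler_wpM2r ?nrm_ge0.
Qed.

(** * The direction routine *)

Lemma cg_yhat_spec {R : realType} {n : nat} (M : 'M[R]_n) (eta : R)
    (g0 : 'cV[R]_n) l :
  let p i := cg_p (cg_iter M eta g0 i) in
  if cg_yhat (cg_iter M eta g0 l) is Some v then
    exists2 k, (k < l)%N & v = cg_candidate g0 (cg_iter M eta g0 k) /\
      forall i, (i < k)%N -> eta * dot (p i) (p i) < quad M (p i)
  else forall i, (i < l)%N -> eta * dot (p i) (p i) < quad M (p i).
Proof.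
move=> p; elim: l => [//|l IH].
have -> : cg_yhat (cg_iter M eta g0 l.+1)
        = cg_record M eta g0 (cg_iter M eta g0 l).
  by rewrite {1}/cg_iter iterS -/(cg_iter _ _ _ _); case: (cg_iter _ _ _ _).
rewrite /cg_record; case: (cg_yhat _) IH => [v [k kl hv]|curv].
  by exists k => //; exact: ltnW.
case: leP => [small|large]; first by exists l.
by move=> i; rewrite ltnS leq_eqVlt => /orP[/eqP ->|/curv].
Qed.

(** Leaving the loop amounts to a curvature test failure, because
    [quad M p <= 0] implies [quad M p <= eta |p|^2]. *)
Lemma cg_direction_candidate {R : realType} {n : nat} (M : 'M[R]_n) (eta : R)
    (g0 : 'cV[R]_n) L :
  let p i := cg_p (cg_iter M eta g0 i) in
  exists k, cg_direction g0 (cg_iter M eta g0 L)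
            = cg_candidate g0 (cg_iter M eta g0 k) /\
    forall i, (i < k)%N -> eta * dot (p i) (p i) < quad M (p i).
Proof.
move=> p; have := cg_yhat_spec M eta g0 L; rewrite /cg_direction.
case: (cg_yhat _) => [v [k _ [-> curv]]|curv]; first by exists k.
by exists L.
Qed.

(** The model decrease bounds the slope, because [quad M y >= 0]; the growth
    bound and the bound [m] on the number of steps control the length. *)
Lemma cg_candidate_related {R : realType} {n m : nat} (M : 'M[R]_n)
    (L eta : R) (g0 : 'cV[R]_n) k :
  let p i := cg_p (cg_iter M eta g0 i) in
  let y := cg_candidate g0 (cg_iter M eta g0 k) in
  (n <= m)%N -> psd M -> 0 < L -> (forall v, quad M v <= L * dot v v) ->
  0 < eta ->
  (forall i, (i < k)%N -> eta * dot (p i) (p i) < quad M (p i)) ->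
  2 * dot g0 y <= - (Num.min 2 L^-1 * dot g0 g0) /\
  nrm y <= (1 + m%:R * ((1 + L / eta) ^+ m / eta)) * nrm g0.
Proof.
move=> p y nm psdM L0 hL eta0 curv; have [symM _] := psdM.
have H := cg_iter_recurrence M eta g0.
have K1 : 1 <= 1 + L / eta by rewrite lerDl divr_ge0 // ltW.
have K0 : 0 <= 1 + L / eta by apply: le_trans K1.
have pos i : (i < k)%N -> 0 < quad M (p i).
  move=> ik; apply: le_lt_trans (curv i ik).
  by rewrite mulr_ge0 ?dot_ge0 // ltW.
rewrite /y /cg_candidate cg_l_iter.
case: k curv pos {y} => [|k] curv pos.
  rewrite nrmN dotNr mulrN lerN2; split.
    by rewrite ler_wpM2r ?dot_ge0 // ge_min lexx.
  rewrite ler_peMl ?nrm_ge0 // lerDl mulr_ge0 ?ler0n //.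
  rewrite divr_ge0 ?(ltW eta0) //.
  exact: exprn_ge0.
split.
  have := cg_model_decrease L k H symM L0 hL pos.
  have := psdM.2 (cg_y (cg_iter M eta g0 k.+1)).
  have : Num.min 2 L^-1 * dot g0 g0 <= dot g0 g0 / L.
    by rewrite mulrC ler_wpM2l ?dot_ge0 // ge_min lexx orbT.
  lra.
have km : (k.+1 <= m)%N by apply: leq_trans nm; exact: cg_steps_leq H _ pos.
have [_ yk] := cg_growth L eta k.+1 H psdM L0 hL eta0 curv.
apply: le_trans yk _; rewrite ler_wpM2r ?nrm_ge0 //.
apply: (@le_trans _ _ (m%:R * ((1 + L / eta) ^+ m / eta))); last first.
  by rewrite lerDr.
have ieta : 0 <= eta^-1 by rewrite invr_ge0 ltW.
apply: ler_pM; rewrite ?ler0n ?ler_nat //.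
  by rewrite mulr_ge0 // exprn_ge0.
by rewrite ler_wpM2r // ler_weXn2l.
Qed.

(** On a definite matrix the loop is left only when the direction, hence the
    residual, vanishes. *)
Lemma cg_candidate_exact {R : realType} {n : nat} (M : 'M[R]_n) (eta : R)
    (g0 : 'cV[R]_n) L :
  (forall v, quad M v <= 0 -> v = 0) -> cg_exit M eta g0 L ->
  g0 + M *m cg_candidate g0 (cg_iter M eta g0 L) = 0.
Proof.
move=> defM [pos /defM pL]; have H := cg_iter_recurrence M eta g0.
have := cg_p_eq0 L H pos pL; rewrite /cg_candidate cg_l_iter.
case: L {pos pL} => [/= ->|L]; first by rewrite oppr0 mulmx0 addr0.
by rewrite (cg_residual L.+1 H).
Qed.

Lemma card_set_leq {m : nat} (N : {set 'I_m}) : (#|N| <= m)%N.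
Proof. by rewrite -[leqRHS]card_ord max_card. Qed.

Lemma gradient_dot_supported {R : realType} {m : nat} (Q : 'M[R]_m)
    (c : 'cV[R]_m) (N : {set 'I_m}) (x v : 'cV[R]_m) :
  supported N v ->
  dot (gradient Q c x) v = 2 * dot (half_gradient Q c N x) (subvec N v).
Proof.
move=> supp_v; rewrite (dot_subvec N) // /half_gradient dotZl.
by rewrite mulrA divff ?mul1r // pnatr_eq0.
Qed.

(** The constants depend neither on the index set nor on the point, because the
    eigenvalues of principal submatrices are bounded by those of [Q] and the
    number of conjugate gradient steps by the dimension. *)
Lemma direction_gradient_related {R : realType} {m : nat} (Q : 'M[R]_m)
    (c : 'cV[R]_m) (L eta : R) :
  psd Q -> 0 < L -> (forall v, quad Q v <= L * dot v v) -> 0 < eta ->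
  exists s1 s2 : R, [/\ 0 < s1, 0 < s2 &
    forall (N : {set 'I_m}) (xt dk xbar : 'cV[R]_m),
      direction_routine Q c eta N xt dk xbar ->
      [/\ supported N dk,
          dot (gradient Q c xt) dk
            <= - (s1 * nrm (half_gradient Q c N xt) ^+ 2)
        & nrm dk <= s2 * nrm (half_gradient Q c N xt)]].
Proof.
move=> psdQ L0 hL eta0.
exists (Num.min 2 L^-1), (1 + m%:R * ((1 + L / eta) ^+ m / eta)); split.
- by rewrite lt_min ltr0n invr_gt0.
- apply: ltr_wpDr => //; rewrite mulr_ge0 ?ler0n // divr_ge0 ?(ltW eta0) //.
  by rewrite exprn_ge0 // addr_ge0 // divr_ge0 // ltW.
move=> N xt dk xbar [l [_ /subvec_setC0 suppd dE _ _]].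
split=> //; rewrite ?(gradient_dot_supported _ _ N) // ?(nrm_subvec N) // dE;
  have [k [-> curv]] := cg_direction_candidate (submat N Q) eta
    (half_gradient Q c N xt) l;
  have [h1 h2] := cg_candidate_related (submat N Q) L eta _ k
    (card_set_leq N) (submat_psd N _ psdQ) L0 (submat_quad_le N _ _ hL)
    eta0 curv => //.
by rewrite nrm_sqr.
Qed.

Lemma half_gradient_shift {R : realType} {m : nat} (Q : 'M[R]_m)
    (c : 'cV[R]_m) (N : {set 'I_m}) (x v : 'cV[R]_m) :
  supported N v ->
  half_gradient Q c N (x + v)
    = half_gradient Q c N x + submat N Q *m subvec N v.
Proof.
move=> supp_v; rewrite mulmx_subvec // /half_gradient /gradient mulmxDr.
rewrite scalerDr addrAC subvecD scalerDr (subvecZ N 2 (Q *m v)).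
by rewrite scalerA mulVf ?scale1r // pnatr_eq0.
Qed.

Lemma direction_point_stationary {R : realType} {m : nat} (Q : 'M[R]_m)
    (c : 'cV[R]_m) (eta : R) (N : {set 'I_m}) (xt dk xbar : 'cV[R]_m) :
  (forall v, supported N v -> quad Q v <= 0 -> v = 0) ->
  supported N xt -> direction_routine Q c eta N xt dk xbar ->
  supported N xbar /\ half_gradient Q c N xbar = 0.
Proof.
move=> defQ suppx [l [hexit _ _ /subvec_setC0 suppb bE]]; split=> //.
have suppv : supported N (xbar - xt) by exact: supportedB.
rewrite -(addrNK xt xbar) addrC half_gradient_shift // subvecB bE.
rewrite [_ - subvec N xt]addrAC subrr add0r.
apply: cg_candidate_exact hexit => y qy.
rewrite -(subvec_extend N y) in qy *.
rewrite quad_submat in qy; last exact: supported_extend.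
by rewrite (defQ _ (supported_extend _ _) qy) subvecE mulmx0.
Qed.

(** * Decrease of the objective in one iteration *)

Lemma objective_shift {R : realType} {m : nat} (Q : 'M[R]_m) (c : 'cV[R]_m)
    (d : R) (x v : 'cV[R]_m) :
  Q^T = Q ->
  objective Q c d (x + v)
    = objective Q c d x + dot (gradient Q c x) v + quad Q v.
Proof.
move=> symQ; rewrite /objective /gradient quadD // dotDr dotDl dotZl.
by rewrite (dotC (Q *m x) v) (dot_sym Q x v symQ); ring.
Qed.

Lemma gradient_shift {R : realType} {m : nat} (Q : 'M[R]_m) (c : 'cV[R]_m)
    (x v : 'cV[R]_m) :
  gradient Q c (x + v) = gradient Q c x + 2 *: (Q *m v).
Proof. by rewrite /gradient mulmxDr scalerDr addrAC. Qed.

Lemma gradient_lipschitz {R : realType} {m : nat} (Q : 'M[R]_m)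
    (c : 'cV[R]_m) (L : R) (x y : 'cV[R]_m) i :
  0 <= L -> psd Q -> (forall v, quad Q v <= L * dot v v) ->
  `|gradient Q c y i ord0 - gradient Q c x i ord0| <= 2 * L * nrm (y - x).
Proof.
move=> L0 psdQ hL.
have -> : gradient Q c y = gradient Q c x + 2 *: (Q *m (y - x)).
  by rewrite -gradient_shift addrC addrNK.
rewrite [X in X - _]mxE addrAC subrr add0r.
apply: le_trans (coord_le_nrm _ _) _.
rewrite nrmZ ger0_norm ?ler0n // -mulrA ler_wpM2l ?ler0n //.
exact: nrm_mulmx_le.
Qed.

Lemma xtilde_supported {R : realType} {m : nat} (Q : 'M[R]_m) (c : 'cV[R]_m)
    (eps : R) (x : 'cV[R]_m) :
  supported (nonactive Q c eps x) (xtilde Q c eps x).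
Proof. by move=> i iN; rewrite mxE (negbTE iN). Qed.

(** With [L = 1 / (2 eps)], discarding the estimated active variables gains
    [|v|^2 / eps] to first order, since [x i <= eps * g i] there, and loses at
    most half of this to second order. *)
Lemma xtilde_decrease {R : realType} {m : nat} (Q : 'M[R]_m) (c : 'cV[R]_m)
    (d eps L : R) (x : 'cV[R]_m) :
  Q^T = Q -> 0 < eps -> L = (2 * eps)^-1 ->
  (forall v, quad Q v <= L * dot v v) -> nonneg x ->
  objective Q c d (xtilde Q c eps x)
    <= objective Q c d x - L * nrm (xtilde Q c eps x - x) ^+ 2.
Proof.
move=> symQ eps0 LE hL x0; set v := xtilde Q c eps x - x.
have -> : xtilde Q c eps x = x + v by rewrite addrC addrNK.
rewrite objective_shift // nrm_sqr.
suff : dot (gradient Q c x) v <= - (2 * L * dot v v).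
  have := hL v; lra.
have -> : 2 * L = eps^-1.
  by rewrite LE invfM mulrA divff ?mul1r // pnatr_eq0.
rewrite !dotE mulr_sumr -sumrN; apply: ler_sum => i _.
have -> : v i ord0 = if i \in nonactive Q c eps x then 0 else - x i ord0.
  by rewrite !mxE; case: ifP => _; rewrite ?subrr ?sub0r.
case: ifPn => [_|]; first by rewrite !mulr0 oppr0.
rewrite inE -leNgt => xg; rewrite mulrNN mulrN lerN2 mulrA.
by apply: ler_wpM2r; [exact: x0|rewrite ler_pdivrMl].
Qed.

Lemma pospart_nonneg {R : realType} {m : nat} (z : 'cV[R]_m) :
  nonneg (pospart z).
Proof. by move=> i; rewrite mxE le_max lexx. Qed.

(** Clipping a coordinate [i] of the step costs something to first order only
    if [g i] is positive at [xtilde].  But an index outside the active set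
    estimate satisfies [g i < x i / eps] at [x], and clipping means that [x i]
    is at most the length of the step: the cost is of second order, up to the
    change of the gradient between [x] and [xtilde]. *)
Lemma projected_step_bound {R : realType} {m : nat} (Q : 'M[R]_m)
    (c : 'cV[R]_m) (d eps L a : R) (x dk : 'cV[R]_m) :
  let xt := xtilde Q c eps x in
  let r := nrm (xt - x) in
  let D := nrm dk in
  psd Q -> 0 < eps -> 0 <= L -> (forall v, quad Q v <= L * dot v v) ->
  nonneg x -> supported (nonactive Q c eps x) dk -> 0 <= a ->
  objective Q c d (pospart (xt + a *: dk))
    <= objective Q c d xt + a * dot (gradient Q c xt) dk
       + a * (m%:R * (a * D ^+ 2 / eps + 2 * L * r * D) + L * a * D ^+ 2).
Proof.
move=> xt r D psdQ eps0 L0 hL x0 suppd a0; have [symQ _] := psdQ.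
set w := pospart (xt + a *: dk) - xt.
have -> : pospart (xt + a *: dk) = xt + w by rewrite /w addrCA subrr addr0.
have r0 : 0 <= r by exact: nrm_ge0.
have D0 : 0 <= D by exact: nrm_ge0.
have wE i : w i ord0 =
    Num.max 0 (xt i ord0 + a * dk i ord0) - xt i ord0 by rewrite !mxE.
have xt0 i : 0 <= xt i ord0 by rewrite mxE; case: ifP.
have w_le i : `|w i ord0| <= `|(a *: dk) i ord0|.
  rewrite wE [in leRHS]mxE; have := xt0 i.
  case: (leP 0 (xt i ord0 + a * dk i ord0)) => h ht.
    by rewrite addrC addKr.
  by rewrite sub0r normrN ger0_norm // ler0_norm; lra.
have quadw : quad Q w <= L * (a * D) ^+ 2.
  apply: le_trans (hL w) _; rewrite ler_wpM2l // -nrm_sqr.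
  rewrite ler_sqr ?nnegrE ?nrm_ge0 ?mulr_ge0 //.
  apply: le_trans (nrm_mono _ _ w_le) _.
  by rewrite nrmZ ger0_norm.
pose B := a * D / eps + 2 * L * r.
have B0 : 0 <= B.
  by rewrite addr_ge0 // ?divr_ge0 ?mulr_ge0 // ltW.
have coord i : gradient Q c xt i ord0 * w i ord0
    <= a * (gradient Q c xt i ord0 * dk i ord0) + B * (a * D).
  have BaD : 0 <= B * (a * D) by rewrite !mulr_ge0.
  have [iN|iN] := boolP (i \in nonactive Q c eps x); last first.
    rewrite wE (xtilde_supported _ _ _ _ _ iN) (suppd _ iN).
    by rewrite !mulr0 addr0 maxxx subr0 !mulr0 add0r.
  have xtE : xt i ord0 = x i ord0 by rewrite mxE iN.
  rewrite wE; have := xt0 i.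
  set t := xt i ord0 + a * dk i ord0.
  case: (leP 0 t) => ht hx.
    by rewrite /t addrC addKr mulrCA lerDl.
  have ad : a * `|dk i ord0| <= a * D by rewrite ler_wpM2l // coord_le_nrm.
  have ndk : - dk i ord0 <= `|dk i ord0| by rewrite -normrN ler_norm.
  have ad' := ler_wpM2l a0 ndk.
  have tD : - t <= a * D by rewrite /t; lra.
  have gB : gradient Q c xt i ord0 <= B.
    have gx : gradient Q c x i ord0 <= a * D / eps.
      rewrite ler_pdivlMr // mulrC; move: iN; rewrite inE => iN.
      apply: le_trans (ltW iN) _; rewrite -xtE /t in ht *; lra.
    have := gradient_lipschitz Q c L x xt i L0 psdQ hL.
    have := ler_norm (gradient Q c xt i ord0 - gradient Q c x i ord0).
    rewrite /B -/r; lra.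
  rewrite sub0r.
  have -> : gradient Q c xt i ord0 * - xt i ord0
      = a * (gradient Q c xt i ord0 * dk i ord0)
        + gradient Q c xt i ord0 * - t by rewrite /t; ring.
  rewrite lerD2l; apply: (@le_trans _ _ (B * - t)).
    by rewrite ler_wpM2r // oppr_ge0 ltW.
  by rewrite ler_wpM2l.
have gw : dot (gradient Q c xt) w
    <= a * dot (gradient Q c xt) dk + m%:R * (B * (a * D)).
  rewrite !dotE mulr_sumr.
  have -> : m%:R * (B * (a * D)) = \sum_(i < m) (B * (a * D)).
    by rewrite sumr_const card_ord mulr_natl.
  by rewrite -big_split /=; apply: ler_sum => i _; exact: coord.
rewrite objective_shift //.
have -> : a * (m%:R * (a * D ^+ 2 / eps + 2 * L * r * D) + L * a * D ^+ 2)
    = m%:R * (B * (a * D)) + L * (a * D) ^+ 2 by rewrite /B; ring.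
by move: gw quadw; lra.
Qed.

(** For gradient related directions the bound of [projected_step_bound] is
    dominated by the predicted decrease when the step is short and when the
    discarded part of [x] is small in comparison with the gradient. *)
Lemma short_step_sufficient_decrease {R : realType} {m : nat} (Q : 'M[R]_m)
    (c : 'cV[R]_m) (d eps gamma L s1 s2 a h : R) (x dk : 'cV[R]_m) :
  let xt := xtilde Q c eps x in
  psd Q -> 0 < eps -> 0 < L -> (forall v, quad Q v <= L * dot v v) ->
  gamma < 1 / 2 -> 0 < s1 -> 0 < s2 -> 0 <= h ->
  nonneg x -> supported (nonactive Q c eps x) dk ->
  dot (gradient Q c xt) dk <= - (s1 * h ^+ 2) -> nrm dk <= s2 * h ->
  nrm (xt - x) <= s1 / (8 * (m%:R + 1) * L * s2) * h ->
  0 <= a <= s1 / (4 * (m%:R / eps + L) * s2 ^+ 2) ->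
  objective Q c d (pospart (xt + a *: dk))
    <= objective Q c d xt + gamma * a * dot (gradient Q c xt) dk.
Proof.
move=> xt psdQ eps0 L0 hL gamma_lt s10 s20 h0 x0 suppd slope size rh.
move=> /andP[a0 a_le].
apply: le_trans (projected_step_bound Q c d eps L a x dk psdQ eps0 (ltW L0)
  hL x0 suppd a0) _; rewrite -/xt.
set r := nrm (xt - x) in rh *; set D := nrm dk in size *.
set gd := dot _ dk in slope *.
have m0 : 0 <= m%:R :> R := ler0n _ m.
have r0 : 0 <= r by exact: nrm_ge0.
have D0 : 0 <= D by exact: nrm_ge0.
have C0 : 0 < m%:R / eps + L by rewrite ltr_wpDl // divr_ge0 // ltW.
have D2 : D ^+ 2 <= s2 ^+ 2 * h ^+ 2.
  by rewrite -exprMn ler_sqr // nnegrE // mulr_ge0 // ltW.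
have E1 : a * (m%:R / eps + L) * D ^+ 2 <= s1 / 4 * h ^+ 2.
  apply: (@le_trans _ _ (a * (m%:R / eps + L) * (s2 ^+ 2 * h ^+ 2))).
    by rewrite ler_wpM2l // mulr_ge0 // ltW.
  rewrite mulrA; apply: ler_wpM2r; first exact: sqr_ge0.
  move: a_le; rewrite ler_pdivlMr; last by rewrite !mulr_gt0 // exprn_gt0.
  lra.
have E2 : 2 * m%:R * L * (r * D) <= s1 / 4 * h ^+ 2.
  have rD : r * D <= s1 / (8 * (m%:R + 1) * L * s2) * h * (s2 * h).
    exact: ler_pM.
  have mL : 0 <= 2 * m%:R * L by rewrite !mulr_ge0 // ltW.
  apply: le_trans (ler_wpM2l mL rD) _.
  have -> : 2 * m%:R * L * (s1 / (8 * (m%:R + 1) * L * s2) * h * (s2 * h))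
      = s1 / 4 * h ^+ 2 * (m%:R / (m%:R + 1)).
    by field; rewrite !gt_eqF // ltr_wpDl.
  rewrite ler_piMr //; first by rewrite mulr_ge0 ?sqr_ge0 // divr_ge0 // ltW.
  by rewrite ler_pdivrMr ?ltr_wpDl // mul1r lerDl.
rewrite -addrA lerD2l -subr_ge0.
have -> : gamma * a * gd - (a * gd + a * (m%:R * (a * D ^+ 2 / eps
    + 2 * L * r * D) + L * a * D ^+ 2))
  = a * (- (1 - gamma) * gd - (a * (m%:R / eps + L) * D ^+ 2
    + 2 * m%:R * L * (r * D))) by field; rewrite gt_eqF.
apply: mulr_ge0 => //.
have sh : 0 <= s1 * h ^+ 2 by rewrite mulr_ge0 ?sqr_ge0 // ltW.
nra.
Qed.

(** Either the discarded part of [x] dominates the reduced gradient, and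
    removing it already pays for both, or the line search accepts a step that
    is bounded below. *)
Lemma iteration_decrease {R : realType} {m : nat} (Q : 'M[R]_m)
    (c : 'cV[R]_m) (d eps delta gamma eta L : R) :
  psd Q -> 0 < eps -> L = (2 * eps)^-1 ->
  (forall v, quad Q v <= L * dot v v) ->
  0 < delta < 1 -> 0 < gamma < 1 / 2 -> 0 < eta ->
  exists2 k : R, 0 < k & forall x x' : 'cV[R]_m, nonneg x ->
    fastqpa_iteration Q c d eps delta gamma eta x (Running x') ->
    k * (nrm (xtilde Q c eps x - x) ^+ 2
         + nrm (half_gradient Q c (nonactive Q c eps x) (xtilde Q c eps x))
           ^+ 2)
      <= objective Q c d x - objective Q c d x'.
Proof.
move=> psdQ eps0 LE hL /andP[delta0 delta1] /andP[gamma0 gamma_lt] eta0.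
have L0 : 0 < L by rewrite LE invr_gt0 mulr_gt0.
have [s1 [s2 [s10 s20 related]]] :=
  direction_gradient_related Q c L eta psdQ L0 hL eta0.
pose tau := s1 / (8 * (m%:R + 1) * L * s2).
pose abar := s1 / (4 * (m%:R / eps + L) * s2 ^+ 2).
have m0 : 0 <= m%:R :> R := ler0n _ m.
have tau0 : 0 < tau by rewrite divr_gt0 // !mulr_gt0 // ltr_wpDl.
have abar0 : 0 < abar.
  rewrite divr_gt0 // !mulr_gt0 ?exprn_gt0 // ltr_wpDl // divr_ge0 //.
  exact: ltW.
pose alow := Num.min 1 (delta * abar).
have alow0 : 0 < alow by rewrite lt_min ltr01 mulr_gt0.
exists (Num.min (L / 2) (Num.min (L / 2 * tau ^+ 2) (gamma * alow * s1))).
  have L20 : 0 < L / 2 by rewrite divr_gt0.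
  by rewrite !lt_min L20 (mulr_gt0 L20 (exprn_gt0 2 tau0)) /= !mulr_gt0.
move=> x x' x0 it; inversion it as [|? ? ? ?|dk xbar j _ dir _ ls x'E].
rewrite {it x'E} //.
set k := Num.min _ _; set xt := xtilde Q c eps x in dir ls *.
set r := nrm (xt - x); set h := nrm (half_gradient _ _ _ _).
have k1 : k <= L / 2 by rewrite ge_min lexx.
have k2 : k <= L / 2 * tau ^+ 2 by rewrite !ge_min lexx orbT.
have k3 : k <= gamma * alow * s1 by rewrite !ge_min lexx !orbT.
have r0 : 0 <= r by exact: nrm_ge0.
have h0 : 0 <= h by exact: nrm_ge0.
have [suppd slope size] := related _ _ _ _ dir.
rewrite -/h in slope size.
have [symQ _] := psdQ.
have := xtilde_decrease Q c d eps L x symQ eps0 LE hL x0; rewrite -/xt -/r.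
move=> dec1; have [dec2 fails] := ls.
rewrite /sufficient_decrease in dec2.
set q' := objective _ _ _ (pospart _) in dec2 *.
set gd := dot _ _ in slope dec2.
have aj0 i : 0 < delta ^+ i by rewrite exprn_gt0.
have gd0 : s1 * h ^+ 2 <= - gd by rewrite lerNr.
have sh : 0 <= s1 * h ^+ 2 by rewrite mulr_ge0 ?sqr_ge0 // ltW.
have kr : k * r ^+ 2 <= L / 2 * r ^+ 2 by rewrite ler_wpM2r ?sqr_ge0.
have [rh|hr] := leP r (tau * h); last first.
  have hr2 : tau ^+ 2 * h ^+ 2 <= r ^+ 2.
    by rewrite -exprMn ler_sqr ?nnegrE ?(ltW hr) // mulr_ge0 // ltW.
  have kh : k * h ^+ 2 <= L / 2 * r ^+ 2.
    apply: (@le_trans _ _ (L / 2 * tau ^+ 2 * h ^+ 2)).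
      by rewrite ler_wpM2r ?sqr_ge0.
    by rewrite -mulrA ler_wpM2l // divr_ge0 // ltW.
  have : 0 <= gamma * delta ^+ j * - gd.
    by rewrite !mulr_ge0 ?(ltW gamma0) ?(ltW (aj0 _)) //; apply: le_trans gd0.
  rewrite mulrDr; lra.
have along : alow <= delta ^+ j.
  (* The previous trial step was rejected, so it was longer than abar. *)
  case: j fails {dec2 ls q'} => [_|j fails]; first by rewrite ge_min lexx.
  rewrite ge_min; apply/orP; right; rewrite exprS ler_wpM2l ?(ltW delta0) //.
  rewrite leNgt; apply/negP => small; apply: (fails j (leqnn _)).
  apply: (short_step_sufficient_decrease Q c d eps gamma L s1 s2 _ h) => //.
  by rewrite ltW ?ltW.
have kh : k * h ^+ 2 <= gamma * delta ^+ j * - gd.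
  apply: (@le_trans _ _ (gamma * alow * (s1 * h ^+ 2))).
    by rewrite mulrA ler_wpM2r ?sqr_ge0.
  apply: ler_pM => //; first by rewrite mulr_ge0 // ltW.
  by rewrite ler_wpM2l // ltW.
have : 0 <= L / 2 * r ^+ 2 by rewrite mulr_ge0 ?sqr_ge0 // divr_ge0 // ltW.
rewrite mulrDr; lra.
Qed.

(** * Accumulation points are minimizers *)

Lemma objective_ge_tangent {R : realType} {m : nat} (Q : 'M[R]_m)
    (c : 'cV[R]_m) (d : R) (x y : 'cV[R]_m) :
  psd Q ->
  objective Q c d x + dot (gradient Q c x) (y - x) <= objective Q c d y.
Proof.
move=> [symQ psdQ].
rewrite -[y in leRHS](addrNK x) [y - x + x]addrC objective_shift //.
by rewrite lerDl.
Qed.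

Lemma kkt_minimizer {R : realType} {m : nat} (Q : 'M[R]_m) (c : 'cV[R]_m)
    (d : R) (x : 'cV[R]_m) :
  psd Q -> nonneg x -> (forall i, 0 <= gradient Q c x i ord0) ->
  (forall i, 0 < x i ord0 -> gradient Q c x i ord0 = 0) ->
  minimizer Q c d x.
Proof.
move=> psdQ x0 g0 compl; split=> // y y0.
apply: le_trans (objective_ge_tangent Q c d x y psdQ).
rewrite lerDl dotE; apply: sumr_ge0 => i _.
have := x0 i; rewrite le_eqVlt => /orP[/eqP xi|/compl ->]; last first.
  by rewrite mul0r.
by rewrite mulr_ge0 // !mxE -xi subr0.
Qed.

Lemma accumulation_point_near {R : realType} {m : nat} (u : nat -> 'cV[R]_m)
    (x : 'cV[R]_m) (e : R) (K : nat) :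
  accumulation_point u x -> 0 < e ->
  exists2 k, (K <= k)%N & nrm (u k - x) < e.
Proof.
move=> acc e0; pose e' := e / (m%:R + 1).
have m1 : 0 < m%:R + 1 :> R by rewrite ltr_wpDl.
have e'0 : 0 < e' by rewrite divr_gt0.
have [] := acc [set y | exists2 k, (K <= k)%N & y = u k] (ball x e').
- by exists K => // k /= Kk; exists k.
- exact: nbhsx_ballx.
move=> _ [[k Kk ->] [_ near_x]]; exists k => //.
apply: le_lt_trans (nrm_le_sum _) _.
apply: (@le_lt_trans _ _ (\sum_(i < m) e')).
  apply: ler_sum => i _; rewrite !mxE distrC ltW //.
  exact: near_x i ord0.
rewrite sumr_const card_ord -mulr_natr /e' mulrAC ltr_pdivrMr //.
by rewrite ltr_pM2l // ltrDl.
Qed.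

(** A convex function is at least its tangent at [x], so near [x] it cannot be
    much smaller than at [x]. *)
Lemma objective_accumulation_le {R : realType} {m : nat} (Q : 'M[R]_m)
    (c : 'cV[R]_m) (d : R) (u : nat -> 'cV[R]_m) (x : 'cV[R]_m) k :
  psd Q -> accumulation_point u x ->
  (forall k, objective Q c d (u k.+1) <= objective Q c d (u k)) ->
  objective Q c d x <= objective Q c d (u k).
Proof.
move=> psdQ acc dec; apply/ler_addgt0Pr => e e0.
pose G := nrm (gradient Q c x) + 1.
have G0 : 0 < G by rewrite ltr_wpDl // nrm_ge0.
have [l kl near_x] := accumulation_point_near u x (e / G) k acc
  (divr_gt0 e0 G0).
have lk : objective Q c d (u l) <= objective Q c d (u k).
  elim: l kl {near_x} => [|l IH]; first by rewrite leqn0 => /eqP ->.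
  by rewrite leq_eqVlt => /orP[/eqP ->//|/IH]; exact: le_trans (dec l).
have := objective_ge_tangent Q c d x (u l) psdQ.
have := dot_le_nrm (gradient Q c x) (u l - x).
have : nrm (gradient Q c x) * nrm (u l - x) <= e.
  move: near_x; rewrite ltr_pdivlMr // => /ltW; apply: le_trans.
  by rewrite mulrC ler_wpM2l ?nrm_ge0 // lerDl.
have := ler_norm (- dot (gradient Q c x) (u l - x)); rewrite normrN.
lra.
Qed.

(** Near an accumulation point the objective has almost reached its limit, so
    the guaranteed decrease [k * (r ^+ 2 + h ^+ 2)] must be small there. *)
Lemma accumulation_residuals {R : realType} {m : nat} (Q : 'M[R]_m)
    (c : 'cV[R]_m) (d L k : R) (u : nat -> 'cV[R]_m) (x : 'cV[R]_m)
    (r h : nat -> R) :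
  psd Q -> 0 <= L -> (forall v, quad Q v <= L * dot v v) ->
  accumulation_point u x -> 0 < k ->
  (forall n, 0 <= r n) -> (forall n, 0 <= h n) ->
  (forall n, k * (r n ^+ 2 + h n ^+ 2)
             <= objective Q c d (u n) - objective Q c d (u n.+1)) ->
  forall e, 0 < e -> exists n, [/\ nrm (u n - x) < e, r n < e & h n < e].
Proof.
move=> psdQ L0 hL acc k0 r0 h0 dec e e0.
have [symQ _] := psdQ.
pose G := nrm (gradient Q c x) + L + 1.
have G0 : 0 < G by rewrite ltr_wpDl // addr_ge0 // nrm_ge0.
(* At distance t <= 1 from x the objective exceeds its value at x by at most
   G * t, which has to be smaller than the decrease k * e ^+ 2. *)
pose e1 := Num.min (Num.min e 1) (k * e ^+ 2 / G).
have e10 : 0 < e1.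
  by rewrite !lt_min e0 ltr01 divr_gt0 // mulr_gt0 // exprn_gt0.
have [n _ near_x] := accumulation_point_near u x e1 0 acc e10.
have mono j : objective Q c d (u j.+1) <= objective Q c d (u j).
  rewrite -subr_ge0; apply: le_trans (dec j).
  by rewrite mulr_ge0 ?(ltW k0) // addr_ge0 // sqr_ge0.
have low := objective_accumulation_le Q c d u x n.+1 psdQ acc mono.
set t := nrm (u n - x) in near_x.
have t0 : 0 <= t by exact: nrm_ge0.
move: near_x; rewrite !lt_min => /andP[/andP[te t1] tk].
have small : objective Q c d (u n) - objective Q c d x < k * e ^+ 2.
  rewrite -[u n](addrNK x) [u n - x + x]addrC objective_shift //.
  have h1 := ler_norm (dot (gradient Q c x) (u n - x)).
  have h2 := dot_le_nrm (gradient Q c x) (u n - x).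
  have h3 := hL (u n - x); rewrite -nrm_sqr -/t in h2 h3.
  have h4 : L * t ^+ 2 <= L * t.
    by rewrite ler_wpM2l // expr2 ler_piMl // ltW.
  move: tk; rewrite ltr_pdivlMr // /G; lra.
have bound : r n ^+ 2 + h n ^+ 2 < e ^+ 2.
  by rewrite -(ltr_pM2l k0); have := dec n; lra.
have rn := sqr_ge0 (r n); have hn := sqr_ge0 (h n).
exists n; split=> //; rewrite -ltr_sqr ?nnegrE ?(ltW e0) //; lra.
Qed.

(** If [x] and [xtilde] are close to [xs] and the reduced gradient at [xtilde]
    is small, then each coordinate of [xs] satisfies the optimality conditions
    approximately: the gradient is small for an index outside the active set
    estimate; for an index in it, [x i] is small and [g i >= x i / eps >= 0]. *)
Lemma limit_kkt {R : realType} {m : nat} (Q : 'M[R]_m) (c : 'cV[R]_m)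
    (eps L : R) (xs : 'cV[R]_m) :
  psd Q -> 0 < eps -> 0 <= L -> (forall v, quad Q v <= L * dot v v) ->
  (forall e, 0 < e -> exists x : 'cV[R]_m,
    let xt := xtilde Q c eps x in
    [/\ nonneg x, nrm (x - xs) < e, nrm (xt - x) < e
      & nrm (half_gradient Q c (nonactive Q c eps x) xt) < e]) ->
  [/\ nonneg xs, forall i, 0 <= gradient Q c xs i ord0
    & forall i, 0 < xs i ord0 -> gradient Q c xs i ord0 = 0].
Proof.
move=> psdQ eps0 L0 hL approx.
pose C := 2 + 4 * L.
have C0 : 0 < C by rewrite ltr_wpDr // mulr_ge0.
have key i e : 0 < e -> [/\ - e <= xs i ord0,
    - (C * e) <= gradient Q c xs i ord0
  & 2 * e <= xs i ord0 -> gradient Q c xs i ord0 <= C * e].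
  move=> e0; have [x [x0 xxs xtx hx]] := approx e e0.
  set xt := xtilde Q c eps x in xtx hx; set N := nonactive Q c eps x in hx.
  have x_near := coord_le_nrm (x - xs) i; rewrite !mxE ler_norml in x_near.
  have xt_near := coord_le_nrm (xt - x) i.
  have {}xt_near : `|xt i ord0 - x i ord0| <= nrm (xt - x).
    by move: xt_near; rewrite !mxE.
  have g_near y : nrm (y - xs) <= 2 * e ->
      `|gradient Q c y i ord0 - gradient Q c xs i ord0| <= 4 * L * e.
    move=> yxs; apply: le_trans (gradient_lipschitz Q c L xs y i L0 psdQ hL) _.
    by have := ler_wpM2l L0 yxs; lra.
  have xi := x0 i.
  have e20 : 0 <= L * e by rewrite mulr_ge0 // ltW.
  split; first by lra.
    have [iN|iN] := boolP (i \in N).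
      have xtxs : nrm (xt - xs) <= 2 * e.
        rewrite -(addrNK x xt) -addrA; apply: le_trans (nrmD _ _) _; lra.
      have := g_near xt xtxs.
      have := coord_le_nrm (half_gradient Q c N xt) (enum_rank_in iN i).
      rewrite /half_gradient mxE -subvec_coord !ler_norml /C.
      move: hx; rewrite /half_gradient; lra.
    have : 0 <= gradient Q c x i ord0.
      move: iN; rewrite inE -leNgt => h.
      by rewrite -(pmulr_rge0 _ eps0); apply: le_trans h.
    have := g_near x; rewrite ler_norml /C => /(_ ltac:(lra)); lra.
  move=> xe; have [iN|iN] := boolP (i \in N).
    have xtxs : nrm (xt - xs) <= 2 * e.
      rewrite -(addrNK x xt) -addrA; apply: le_trans (nrmD _ _) _; lra.
    have := g_near xt xtxs.
    have := coord_le_nrm (half_gradient Q c N xt) (enum_rank_in iN i).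
    rewrite /half_gradient mxE -subvec_coord !ler_norml /C.
    move: hx; rewrite /half_gradient; lra.
  move: xt_near; rewrite /xt (xtilde_supported _ _ _ _ _ iN) -/xt.
  rewrite ler_norml; lra.
have g0 i : 0 <= gradient Q c xs i ord0.
  rewrite leNgt; apply/negP => g_lt0.
  have e0 : 0 < - gradient Q c xs i ord0 / (2 * C).
    by rewrite divr_gt0 ?mulr_gt0 // oppr_gt0.
  have [_ + _] := key i _ e0.
  have -> : C * (- gradient Q c xs i ord0 / (2 * C))
      = - gradient Q c xs i ord0 / 2 by field; rewrite gt_eqF.
  lra.
split=> // [i|i xi].
  rewrite leNgt; apply/negP => x_lt0.
  have e0 : 0 < - xs i ord0 / 2 by lra.
  have [+ _ _] := key i _ e0; lra.
apply/le_anti; rewrite g0 andbT leNgt; apply/negP => g_gt0.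
set g := gradient Q c xs i ord0 in g_gt0.
have e0 : 0 < Num.min (xs i ord0 / 2) (g / (2 * C)).
  by rewrite lt_min !divr_gt0 ?mulr_gt0.
have [_ _] := key i _ e0.
have le1 : Num.min (xs i ord0 / 2) (g / (2 * C)) <= xs i ord0 / 2.
  by rewrite ge_min lexx.
have le2 : Num.min (xs i ord0 / 2) (g / (2 * C)) <= g / (2 * C).
  by rewrite ge_min lexx orbT.
move/(_ ltac:(lra)); have := ler_wpM2l (ltW C0) le2.
have -> : C * (g / (2 * C)) = g / 2 by field; rewrite gt_eqF.
rewrite -/g; lra.
Qed.

(** * Identification of the active set and termination *)

Lemma nonzero_gap {R : realType} {m : nat} (f : 'I_m -> R) :
  exists2 e : R, 0 < e & forall i, f i != 0 -> e <= `|f i|.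
Proof.
exists (\big[Num.min/1]_(i | f i != 0) `|f i|).
  by apply: lt_bigmin => // i fi; rewrite normr_gt0.
by move=> i fi; exact: bigmin_le_cond.
Qed.

(** The index set is determined by the signs of [x i - eps * g i], which are
    stable near a stationary point except where both terms vanish. *)
Lemma nonactive_near {R : realType} {m : nat} (Q : 'M[R]_m) (c : 'cV[R]_m)
    (eps L : R) (xs : 'cV[R]_m) :
  psd Q -> 0 < eps -> 0 <= L -> (forall v, quad Q v <= L * dot v v) ->
  nonneg xs -> (forall i, 0 <= gradient Q c xs i ord0) ->
  (forall i, 0 < xs i ord0 -> gradient Q c xs i ord0 = 0) ->
  exists2 e : R, 0 < e & forall x : 'cV[R]_m, nrm (x - xs) < e ->
    supported (nonactive Q c eps x) xs /\
    nonactive Q c eps x \subset Nhat Q c xs.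
Proof.
move=> psdQ eps0 L0 hL xs0 g0 compl.
pose f (x : 'cV[R]_m) i := x i ord0 - eps * gradient Q c x i ord0.
have [e1 e10 gap] := nonzero_gap (f xs).
(* A Lipschitz constant of each coordinate of f. *)
pose K := 1 + eps * (2 * L).
have K0 : 0 < K by rewrite ltr_wpDr // !mulr_ge0 // ltW.
exists (e1 / K); first by rewrite divr_gt0.
move=> x; rewrite ltr_pdivlMr // => near_x.
have f_near i : `|f x i - f xs i| < e1.
  apply: le_lt_trans near_x; rewrite mulrDr mulr1.
  have -> : f x i - f xs i = (x i ord0 - xs i ord0)
      - eps * (gradient Q c x i ord0 - gradient Q c xs i ord0).
    by rewrite /f; ring.
  apply: le_trans (ler_normB _ _) _; apply: lerD.
    by have := coord_le_nrm (x - xs) i; rewrite !mxE.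
  rewrite normrM (gtr0_norm eps0) [leRHS]mulrC -mulrA ler_wpM2l ?(ltW eps0) //.
  exact: gradient_lipschitz.
have inN i : (i \in nonactive Q c eps x) = (0 < f x i).
  by rewrite inE subr_gt0.
split=> [i|]; last first.
  apply/fintype.subsetP => i; rewrite inN !inE => fx.
  have := xs0 i; rewrite le_eqVlt => /orP[/eqP xi|->//].
  rewrite -xi eqxx ltxx /=; apply: contraTT fx => gi.
  have fxs : f xs i = - (eps * gradient Q c xs i ord0).
    by rewrite /f -xi sub0r.
  have gi0 : 0 < eps * gradient Q c xs i ord0.
    by rewrite mulr_gt0 // lt_def gi g0.
  have := gap i; rewrite fxs oppr_eq0 gt_eqF // normrN gtr0_norm //.
  move=> /(_ isT); have := f_near i; rewrite fxs ltr_norml -leNgt; lra.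
rewrite inN => fx; apply/le_anti; rewrite xs0 andbT leNgt.
apply: contra fx => xi; have fxs : f xs i = xs i ord0.
  by rewrite /f compl // mulr0 subr0.
have := gap i; rewrite fxs gt_eqF // gtr0_norm // => /(_ isT).
have := f_near i; rewrite fxs ltr_norml; lra.
Qed.

(** Both points are stationary for the restriction of the objective to the
    vectors supported on [N], which is strictly convex. *)
Lemma stationary_unique {R : realType} {m : nat} (Q : 'M[R]_m)
    (c : 'cV[R]_m) (N : {set 'I_m}) (x y : 'cV[R]_m) :
  (forall v, supported N v -> quad Q v <= 0 -> v = 0) ->
  supported N x -> supported N y ->
  half_gradient Q c N x = 0 -> half_gradient Q c N y = 0 -> y = x.
Proof.
move=> defQ suppx suppy hx hy.
have suppv : supported N (y - x) by exact: supportedB.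
apply/eqP; rewrite -subr_eq0; apply/eqP; apply: defQ => //.
have := half_gradient_shift Q c N x _ suppv.
rewrite [x + _]addrC addrNK hx hy add0r mulmx_subvec // => /esym Qv.
by rewrite quadE dotC (dot_subvec N) // Qv dot0l.
Qed.

Lemma direction_point_unique {R : realType} {m : nat} (Q : 'M[R]_m)
    (c : 'cV[R]_m) (eps eta : R) (x xs dk xbar : 'cV[R]_m) :
  let N := nonactive Q c eps x in
  posdef (submat (Nhat Q c xs) Q) ->
  (forall i, 0 < xs i ord0 -> gradient Q c xs i ord0 = 0) ->
  supported N xs -> N \subset Nhat Q c xs ->
  direction_routine Q c eta N (xtilde Q c eps x) dk xbar -> xbar = xs.
Proof.
move=> N pdQ compl suppxs NNhat dir.
have defQ v : supported N v -> quad Q v <= 0 -> v = 0.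
  move=> suppv; apply: posdef_supported pdQ _.
  exact: supported_subset NNhat suppv.
have [suppb hb] := direction_point_stationary Q c eta N _ dk xbar defQ
  (xtilde_supported Q c eps x) dir.
apply: (stationary_unique Q c N) => //.
apply/matrixP => j l; rewrite (ord1 l) !mxE.
have : enum_val j \in Nhat Q c xs.
  by apply: (fintype.subsetP NNhat); exact: enum_valP.
suff g0 : enum_val j \in Nhat Q c xs ->
    gradient Q c xs (enum_val j) ord0 = 0.
  by move=> /g0; rewrite !mxE => ->; rewrite mulr0.
by rewrite !inE => /orP[/compl|/andP[_ /eqP]].
Qed.

Lemma run_infinite {R : realType} {m : nat} {Q : 'M[R]_m} {c : 'cV[R]_m}
    {d eps delta gamma eta : R} {x0 : 'cV[R]_m} {s : nat -> status R m} :
  fastqpa_run Q c d eps delta gamma eta x0 s -> nonneg x0 ->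
  (forall k z, s k = Stopped z -> ~ minimizer Q c d z) ->
  let u k := status_point (s k) in
  forall k, nonneg (u k) /\
    fastqpa_iteration Q c d eps delta gamma eta (u k) (Running (u k.+1)).
Proof.
move=> [s0 srun] x00 nostop u.
have step k x : s k = Running x ->
    exists2 y, s k.+1 = Running y & nonneg y /\
      fastqpa_iteration Q c d eps delta gamma eta x (Running y).
  move=> skx; have := srun k; rewrite skx => it.
  inversion it as [opt E|dk xbar _ _ opt E|dk xbar j nopt dir nopt' ls E].
  - by case: (nostop k.+1 x).
  - by case: (nostop k.+1 xbar).
  - eexists; first by [].
    by split; [exact: pospart_nonneg|exact: Next_iterate dir nopt' ls].
have running k : s k = Running (u k) /\ nonneg (u k).
  elim: k => [|k [sk _]]; first by rewrite /u s0.
  by have [y sy [y0 _]] := step _ _ sk; rewrite /u sy.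
move=> k; have [sk uk0] := running k; split=> //.
by have [y sy [_]] := step _ _ sk; rewrite /u sy.
Qed.

Theorem theorem2p15 (R : realType) (m : nat) (Q : 'M[R]_m) (c : 'cV[R]_m)
    (d lmax eps delta gamma eta : R) (x0 xstar : 'cV[R]_m)
    (s : nat -> status R m)
    (hQ : psd Q)
    (hlmax : is_largest_eigenvalue Q lmax)
    (heps : 0 < eps) (heps_lmax : eps * (2 * lmax) < 1)
    (hdelta : 0 < delta < 1)
    (hgamma : 0 < gamma < 1 / 2)
    (heta : 0 < eta)
    (hx0 : nonneg x0)
    (hrun : fastqpa_run Q c d eps delta gamma eta x0 s)
    (hacc : accumulation_point (fun k => status_point (s k)) xstar)
    (hpd : posdef (submat (Nhat Q c xstar) Q)) :
  exists (k : nat) (z : 'cV[R]_m), s k = Stopped z /\ minimizer Q c d z.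
Proof.
apply: contrapT => nostop.
have {}nostop k z : s k = Stopped z -> ~ minimizer Q c d z.
  by move=> skz minz; apply: nostop; exists k, z.
have run := run_infinite hrun hx0 nostop.
set u := fun k => status_point (s k) in hacc run.
have [L LE] : exists L, L = (2 * eps)^-1 by exists (2 * eps)^-1.
have L0 : 0 < L by rewrite LE invr_gt0 mulr_gt0.
have hL v : quad Q v <= L * dot v v.
  apply: le_trans (symmetric_spectral_bound Q lmax hQ.1 hlmax v) _.
  apply: ler_wpM2r; first exact: dot_ge0.
  by rewrite LE -div1r ler_pdivlMr ?mulr_gt0 //; lra.
have [k k0 dec] :=
  iteration_decrease Q c d eps delta gamma eta L hQ heps LE hL hdelta hgamma
    heta.
have [xs0 g0 compl] : [/\ nonneg xstar,
    forall i, 0 <= gradient Q c xstar i ord0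
  & forall i, 0 < xstar i ord0 -> gradient Q c xstar i ord0 = 0].
  apply: (limit_kkt Q c eps L xstar hQ heps (ltW L0) hL) => e e0.
  have [n [n1 n2 n3]] := accumulation_residuals Q c d L k u xstar _ _ hQ
    (ltW L0) hL hacc k0 (fun n => nrm_ge0 _) (fun n => nrm_ge0 _)
    (fun n => dec (u n) (u n.+1) (run n).1 (run n).2) e e0.
  by exists (u n); split=> //; exact: (run n).1.
have opt := kkt_minimizer Q c d xstar hQ xs0 g0 compl.
have [e e0 near_xs] :=
  nonactive_near Q c eps L xstar hQ heps (ltW L0) hL xs0 g0 compl.
have [n _ /near_xs[supp_xs sub_Nhat]] :=
  accumulation_point_near u xstar e 0 hacc e0.
have [_ it] := run n.
inversion it as [|? ? ? ?|dk xbar j nopt dir nopt' ls E].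
by apply: nopt';
  rewrite (direction_point_unique Q c eps eta (u n) xstar dk xbar).
Qed.
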